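(* Let $k\ge 1$. There is a functorial assignment $X\mapsto \Delta^k(X)$ from affine varieties to affine varieties over $(\mathbb{C}^k)^{\circ}$ (i.e. a functor from the category of affine varieties over $\mathbb{C}$ to the category of affine varieties equipped with a morphism to $(\mathbb{C}^k)^{\circ}$) such that, for every affine variety $X$ and every $P=(m_1,\ldots,m_k)\in\mathbb{N}^k\subset\mathbb{C}^k$, the reduced fiber of $\Delta^k(X)\to(\mathbb{C}^k)^\circ$ over $P$ is precisely the $(m_1,\ldots,m_k)$-incidence stratum $$\Delta^k_P(X)\subset \mathrm{Sym}^{m_1+\ldots+m_k}X.$$
   Context: Everything is over $\mathbb{C}$; affine varieties are reduced, of finite type, not necessarily irreducible. $\mathbb{N}$ denotes the positive integers. $$(\mathbb{C}^k)^{\circ}=\mathbb{C}^k\setminus\bigcup_{\emptyset\ne S\subset\{1,\ldots,k\}}\Big\{(m_1,\ldots,m_k):\sum_{i\in S}m_i=0\Big\}.$$ $\mathrm{Sym}^dX=X^d/S_d$ is the variety of unordered $d$-tuples of points of $X$ (effective zero-cycles of degree $d$). For $P=(m_1,\ldots,m_k)\in\mathbb{N}^k$ and $d=m_1+\cdots+m_k$, the (closed) incidence stratum $\Delta^k_P(X)\subset \mathrm{Sym}^dX$ is the closed subvariety, with reduced structure, of all zero-cycles of the form $m_1x_1+\cdots+m_kx_k$ with $x_1,\ldots,x_k\in X$ not necessarily distinct. The reduced fiber is the scheme-theoretic fiber with its reduced structure. *)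

(* Defs.v *)
From HB Require Import structures.
From mathcomp Require Import all_boot all_order all_algebra.
From mathcomp Require Import mpoly.
From mathcomp Require Import boolp classical_sets reals.
From mathcomp Require Import complex.

Set Implicit Arguments.
Unset Strict Implicit.
Unset Printing Implicit Defensive.

Import GRing.Theory.
Local Open Scope ring_scope.

(* Classical varieties over an algebraically closed field K: a set of points
   together with the set of its globally defined regular functions.  For affine
   varieties this determines everything (the topology, the structure sheaf and
   the morphisms), and reducedness is automatic, because regular functions are
   honest K-valued functions. *)
Record fspace (K : closedFieldType) := Fspace {
  pts :> Type;
  regular : set (pts -> K)
}.
Arguments regular {K} _.

Record mor (K : closedFieldType) (X Y : fspace K) := Mor {
  mor_fun :> X -> Y;
  mor_regular : forall g, regular Y g -> regular X (g \o mor_fun)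
}.

Definition idmor (K : closedFieldType) (X : fspace K) : mor X X :=
  @Mor K X X id (fun g gY => gY).

Definition compmor (K : closedFieldType) (X Y Z : fspace K)
    (g : mor Y Z) (f : mor X Y) : mor X Z :=
  @Mor K X Z (g \o f) (fun h hZ => mor_regular f (mor_regular g hZ)).

Definition is_iso (K : closedFieldType) (X Y : fspace K) (f : mor X Y) :=
  exists g : mor Y X, cancel f g /\ cancel g f.

(* Used below only for Zariski closed A in an affine X; it is then the closed
   subvariety A with its reduced structure, since every regular function on A
   is the restriction of a regular function on X. *)
Definition subspace (K : closedFieldType) (X : fspace K) (A : set X) :
    fspace K :=
  Fspace [set f : {x : X | A x} -> K |
    exists2 g, regular X g & forall x, f x = g (sval x)].

Definition affine_space (K : closedFieldType) (n : nat) : fspace K :=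
  Fspace [set f : ('I_n -> K) -> K |
    exists p : {mpoly K[n]}, forall x, f x = p.@[x]].

Definition zero_locus (K : closedFieldType) (n : nat)
    (I : set {mpoly K[n]}) : set (affine_space K n) :=
  [set x | forall p, I p -> p.@[x] = 0].

Definition is_affine (K : closedFieldType) (X : fspace K) :=
  exists (n : nat) (I : set {mpoly K[n]})
         (f : mor X (subspace (zero_locus I))), is_iso f.

Record affvar (K : closedFieldType) := Affvar {
  affvar_space :> fspace K;
  affvar_affine : is_affine affvar_space
}.

(* X^d; the functions are the image of the d-th tensor power of O(X), which is
   the coordinate ring of X^d when X is affine. *)
Definition power (K : closedFieldType) (X : fspace K) (d : nat) : fspace K :=
  Fspace [set f : ('I_d -> X) -> K |
    exists (N : nat) (c : 'I_N -> K) (g : 'I_N -> 'I_d -> X -> K),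
      (forall j i, regular X (g j i)) /\
      (forall x, f x = \sum_(j < N) c j * \prod_(i < d) g j i (x i))].

(* The effective zero-cycle m_1 x_1 + ... + m_k x_k, given by the multiplicity
   of each point; the x_i need not be distinct. *)
Definition cycle_of (T : Type) (k : nat) (m : 'I_k -> nat) (x : 'I_k -> T) :
    T -> nat :=
  fun p => (\sum_(i < k) m i * `[< x i = p >])%N.

Definition zcycle (T : Type) (d : nat) : Type :=
  {Z : T -> nat | exists x : 'I_d -> T, Z = cycle_of (fun=> 1%N) x}.

Definition sym_quot (T : Type) (d : nat) (x : 'I_d -> T) : zcycle T d :=
  exist _ (cycle_of (fun=> 1%N) x) (ex_intro _ x erefl).

(* Sym^d X = X^d / S_d: two d-tuples have the same cycle iff they differ by a
   permutation, and a function on the quotient is regular iff its pullback to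
   X^d is, i.e. O(Sym^d X) = O(X^d)^(S_d). *)
Definition sym (K : closedFieldType) (X : fspace K) (d : nat) : fspace K :=
  Fspace [set f : zcycle X d -> K |
    regular (power X d) (fun x : 'I_d -> X => f (sym_quot x))].

Definition stratum (K : closedFieldType) (X : fspace K) (k : nat)
    (P : 'I_k -> nat) : fspace K :=
  subspace [set Z : sym X (\sum_(i < k) P i)%N |
    exists x : 'I_k -> X, sval Z = cycle_of P x].

(* (C^k)°, the complement in K^k of the hypersurface where
   \prod_S \sum_(i in S) m_i vanishes, S running over the nonempty subsets;
   its regular functions are quotients of polynomials by powers of this
   product. *)
Definition punctured (K : closedFieldType) (k : nat) : fspace K :=
  Fspace
    [set f : {m : 'I_k -> K | forall S : {set 'I_k},
                S != finset.set0 -> \sum_(i in S) m i != 0} -> K |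
      exists (p : {mpoly K[k]}) (N : nat), forall m,
        f m = p.@[sval m] /
              (\prod_(S : {set 'I_k} | S != finset.set0)
                 \sum_(i in S) sval m i) ^+ N].

Record over (K : closedFieldType) (k : nat) := Over {
  over_var :> affvar K;
  over_str : mor over_var (punctured K k)
}.

Record over_mor (K : closedFieldType) (k : nat) (Y Z : over K k) := OverMor {
  over_mor_mor :> mor Y Z;
  over_mor_str : forall y, over_str Z (over_mor_mor y) = over_str Y y
}.

Record functor (K : closedFieldType) (k : nat) := Functor {
  fobj :> affvar K -> over K k;
  fmap : forall X Y : affvar K, mor X Y -> over_mor (fobj X) (fobj Y);
  fmap_id : forall (X : affvar K) (y : fobj X), fmap (idmor X) y = y;
  fmap_comp : forall (X Y Z : affvar K) (g : mor Y Z) (f : mor X Y)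
    (y : fobj X), fmap (compmor g f) y = fmap g (fmap f y)
}.

(* The reduced fiber over P in N^k, seen in K^k. *)
Definition fiber (K : closedFieldType) (k : nat) (Y : over K k)
    (P : 'I_k -> nat) : fspace K :=
  subspace [set y : Y | forall i, sval (over_str Y y) i = (P i)%:R].

(* phi identifies the fibers with the strata naturally in X, where X |-> strata
   is functorial by pushforward of cycles,
   f_* (\sum_i m_i x_i) = \sum_i m_i f(x_i). *)
Definition natural_on_fibers (K : closedFieldType) (k : nat)
    (F : functor K k) (P : 'I_k -> nat)
    (phi : forall X : affvar K, mor (fiber (F X) P) (stratum X P)) :=
  forall (X Y : affvar K) (f : mor X Y)
         (y : fiber (F X) P) (z : fiber (F Y) P) (x : 'I_k -> X),
    sval z = fmap F f (sval y) ->
    sval (sval (phi X y)) = cycle_of P x ->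
    sval (sval (phi Y z)) = cycle_of P (f \o x).

(* Main.v *)
Require Import Defs.
From mathcomp Require Import all_boot all_order all_algebra.
From mathcomp Require Import mpoly.
From mathcomp Require Import boolp classical_sets reals.
From mathcomp Require Import complex.
From mathcomp Require Import perm functions ring zify.

(* Over K^k° x X^k consider the ring B generated by the functions of
   m in K^k° and the weighted power sums p_h = \sum_i m_i h(x_i), h regular on X;
   Delta^k(X) is Spec B.

   The key point is that B is finitely generated and that K^k° x X^k is finite
   over Spec B.  On K^k° the equations p_1 = ... = p_k = 0 for the power sums of
   one coordinate have only the zero solution, so by a graded Nakayama argument
   the k values of a coordinate are integral over the ring of the p_n with n <= k
   and are killed by one monic polynomial.  Multiplying this equation by m_i and
   summing over i expresses the power sums of high monomials through lower ones,
   which gives finite generation.  By lying over, every K-point of Spec B comes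
   from a tuple (m, x), so the points of Delta^k(X) are the cycles
   \sum_i m_i x_i with coefficients in K.

   Over P in N^k, both the fiber and the stratum carry the ring generated by the
   functions \sum_i P_i h(x_i): in characteristic 0 the S_d-invariant functions on
   X^d are polynomials in the power sums \sum_j h(x_j). *)

Set Implicit Arguments.
Unset Strict Implicit.
Unset Printing Implicit Defensive.

Import GRing.Theory.
Local Open Scope ring_scope.

(** * Common zeros of weighted power sums *)

Definition zmod_set (V : zmodType) (A : set V) :=
  A 0 /\ forall x y, A x -> A y -> A (x - y).

Section ZmodSet.
Variables (V : zmodType) (A : set V).
Hypothesis hA : zmod_set A.

Lemma zmod_setN x : A x -> A (- x).
Proof. by case: hA => A0 AB Ax; rewrite -[- x]add0r; apply: AB. Qed.

Lemma zmod_setD x y : A x -> A y -> A (x + y).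
Proof.
by move=> Ax Ay; rewrite -[y]opprK; case: hA => _; apply=> //; apply: zmod_setN.
Qed.

Lemma zmod_set_sum I (r : seq I) (P : pred I) (F : I -> V) :
  (forall i, P i -> A (F i)) -> A (\sum_(i <- r | P i) F i).
Proof. by move=> AF; apply: big_ind => //; [case: hA | exact: zmod_setD]. Qed.

End ZmodSet.

(** Directness of the sum of the M n is left out on purpose: the application is to the filtration by
    degree in the x_i. *)
Definition graded (R : comPzRingType) (M : nat -> set R) :=
  [/\ forall n, zmod_set (M n), M 0%N 1 &
      forall n l x y, M n x -> M l y -> M (n + l)%N (x * y)].

Definition graded_ideal (R : comPzRingType) (M J : nat -> set R) :=
  (forall n, zmod_set (J n)) /\
  forall n l x y, J n x -> M l y -> J (n + l)%N (x * y).

Section Nilpotency.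
Variables (R : comPzRingType) (M : nat -> set R).
Hypothesis hM : graded M.

Lemma gradedM n l x y : M n x -> M l y -> M (n + l)%N (x * y).
Proof. by case: hM => _ _; apply. Qed.

Lemma gradedX n x e : M n x -> M (n * e)%N (x ^+ e).
Proof.
move=> Mx; elim: e => [|e IH]; first by rewrite muln0 expr0; case: hM.
by rewrite mulnS exprS; apply: gradedM.
Qed.

Lemma graded_prod I (r : seq I) (x : I -> R) n :
  (forall i, M n (x i)) -> M (n * size r)%N (\prod_(i <- r) x i).
Proof.
move=> Mx; elim: r => [|i r IH]; first by rewrite big_nil muln0; case: hM.
by rewrite big_cons mulnS; apply: gradedM.
Qed.

(** Degree n of the ideal J + (y) for y of degree 1: the cofactor b has degree n - 1, and degree 0
    gains nothing. *)
Definition adjoin (J : nat -> set R) (y : R) (n : nat) : set R :=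
  [set f | exists a b, [/\ J n a, (if n is n'.+1 then M n' b else b = 0) &
                           f = a + y * b]].

Lemma adjoin_ideal J y : graded_ideal M J -> graded_ideal M (adjoin J y).
Proof.
move=> [Jz JM]; have [Mz _ _] := hM; split=> [n|n l f g].
  split.
    exists 0, 0; split; [by case: (Jz n)|case: n => // n; by case: (Mz n)|].
    by rewrite mulr0 addr0.
  move=> _ _ [a [b [Ja Mb ->]]] [a' [b' [Ja' Mb' ->]]].
  exists (a - a'), (b - b'); split; last by ring.
    by case: (Jz n) => _; apply.
  case: n Mb Mb' {Ja Ja'} => [-> ->|n Mb Mb']; first by rewrite subr0.
  by case: (Mz n) => _; apply.
move=> [a [b [Ja Mb ->]]] Mg; exists (a * g), (b * g); split; last by ring.
  exact: JM.
case: n Mb {Ja} => [->|n Mb]; last by rewrite addSn; apply: gradedM.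
by rewrite mul0r; case: l {Mg} => //= l; case: (Mz l).
Qed.

Lemma adjoin_sub J y n f : J n f -> adjoin J y n f.
Proof.
move=> Jf; have [Mz _ _] := hM; exists f, 0; split=> //; last by rewrite mulr0 addr0.
by case: n {Jf} => // n; case: (Mz n).
Qed.

Lemma adjoin_mul J y n f : graded_ideal M J -> M n f -> adjoin J y n.+1 (y * f).
Proof. by move=> [Jz _] Mf; exists 0, f; split=> //; [case: (Jz n.+1)|rewrite add0r]. Qed.

(** Multiply the congruences z_i = y_i c_i modulo J; b is the product of the c_i. *)
Lemma adjoin_prod J (I : Type) (r : seq I) (z y : I -> R) N :
    graded_ideal M J -> (forall i, M 1%N (y i)) ->
    (forall i, M N.+1 (z i)) -> (forall i, adjoin J (y i) N.+1 (z i)) ->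
  exists2 b, M (N * size r)%N b &
    J (N.+1 * size r)%N (\prod_(i <- r) z i - (\prod_(i <- r) y i) * b).
Proof.
move=> hJ My Mz Jz; have [Jzm JM] := hJ; elim: r => [|i r [b Mb Jb]].
  exists 1; first by rewrite muln0; case: hM.
  by rewrite !big_nil mulr1 subrr muln0; case: (Jzm 0%N).
have [a [c [Ja Mc zE]]] := Jz i.
exists (c * b); first by rewrite mulnS; apply: gradedM.
rewrite !big_cons; set Z := \prod_(j <- r) z j; set Y := \prod_(j <- r) y j.
have -> : z i * Z - y i * Y * (c * b) = a * Z + (Z - Y * b) * (y i * c).
  by rewrite zE; ring.
apply: zmod_setD => //; first by rewrite mulnS; apply: JM => //; apply: graded_prod.
by rewrite mulnS addnC; apply: JM => //; apply: (@gradedM 1).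
Qed.

(* Passing from the weights w_i to w_i (x_i - x_j) replaces the power sum p_n by
   p_(n+1) - x_j p_n. *)
Lemma weighted_power_sum_prod J k (x : 'I_k -> R) (L : seq 'I_k) (w : 'I_k -> R) a :
    graded_ideal M J -> (forall i, M 1%N (x i)) ->
    (forall n, (0 < n <= (size L).+1)%N ->
       J (n + a)%N (\sum_i w i * x i ^+ n)) ->
  J ((size L).+1 + a)%N (\sum_i w i * (\prod_(j <- L) (x i - x j)) * x i).
Proof.
move=> hJ Mx; have [Jz JM] := hJ.
elim: L w a => [|j L IH] w a Jp.
  have := Jp 1%N isT; congr (J _ _).
  by apply: eq_bigr => i _; rewrite big_nil mulr1 expr1.
have := IH (fun i => w i * (x i - x j)) a.+1.
rewrite /= addnS addSn => IH'.
suff: J ((size L).+1 + a).+1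
        (\sum_i w i * (x i - x j) * \prod_(j0 <- L) (x i - x j0) * x i).
  by congr (J _ _); apply: eq_bigr => i _; rewrite big_cons; ring.
apply: IH' => n /andP[n0 nL].
have -> : \sum_i w i * (x i - x j) * x i ^+ n =
    \sum_i w i * x i ^+ n.+1 - (\sum_i w i * x i ^+ n) * x j.
  by rewrite mulr_suml -sumrB; apply: eq_bigr => i _; rewrite exprS; ring.
rewrite addnS; case: (Jz (n + a).+1) => _; apply.
  by rewrite -addSn; apply: Jp.
by rewrite -addn1; apply: JM => //; apply: Jp; rewrite n0 /= ltnW.
Qed.

(* The common zeros of p_1, ..., p_k are x = 0: each solution has
   x_0 prod_j (x_0 - x_j) = 0, and both on x_0 = 0 and on x_0 = x_j one weight
   disappears. *)
Lemma power_sums_nilpotent k J (m x : 'I_k -> R) :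
    graded_ideal M J ->
    (forall i, M 1%N (x i)) -> (forall i, M 0%N (m i)) ->
    (forall b : 'I_k -> bool, (exists i, b i) ->
       exists2 u, M 0%N u & u * (\sum_(i | b i) m i) = 1) ->
    (forall n, (0 < n <= k)%N -> J n (\sum_i m i * x i ^+ n)) ->
  forall i, J k`! (x i ^+ k`!).
Proof.
elim: k J m x => [|k IH] J m x hJ Mx Mm mu Jp; first by case.
have [Jz JM] := hJ.
(* The product of the y o is x_0 \prod_j (x_0 - x_j): [None] stands for the locus x_0 = 0, [Some j]
   for the locus where x_0 meets the j-th remaining point. *)
pose y (o : option 'I_k) : R :=
  if o is Some j then x ord0 - x (lift ord0 j) else x ord0.
have My o : M 1%N (y o).
  case: o => [j|] //=; have [Mz _ _] := hM; case: (Mz 1%N) => _; exact.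
(* Modulo y o the k remaining points satisfy the same hypotheses once m_0 is dropped ([None]) or
   added to the weight of the point that x_0 meets ([Some j]). *)
have merged o i : adjoin J (y o) k`! (x (lift ord0 i) ^+ k`!).
  pose m' i := (if o == Some i then m ord0 else 0) + m (lift ord0 i).
  apply: (IH _ m' (fun i => x (lift ord0 i))); first exact: adjoin_ideal.
  - by move=> ?; apply: Mx.
  - move=> j; have [Mz _ _] := hM; apply: zmod_setD => //.
    by case: ifP => // _; case: (Mz 0%N).
  - move=> b [i0 bi0].
    (* A partial sum of the new weights is one of the old weights: 0 joins the subset exactly when
       the weight that absorbed m_0 belongs to it. *)
    pose b' i := if unlift ord0 i is Some i' then b i'
                 else if o is Some j then b j else false.
    have [|u Mu uE] := mu b'; first by exists (lift ord0 i0); rewrite /b' liftK.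
    exists u => //; rewrite -uE; congr (_ * _).
    rewrite big_mkcond [in RHS]big_mkcond big_ord_recl /= /b' unlift_none.
    have -> : (if if o is Some j then b j else false then m ord0 else 0) =
              \sum_j (if b j then if o == Some j then m ord0 else 0 else 0).
      case: o {b' u Mu uE m'} => [j|]; last by rewrite big1 // => j _; case: (b j).
      rewrite (bigD1 j) //= eqxx big1 ?addr0 // => j' /negPf j'j.
      by rewrite (inj_eq (@Some_inj _)) eq_sym j'j; case: ifP.
    rewrite -big_split; apply: eq_bigr => j _ /=; rewrite liftK.
    by case: (b j); rewrite ?addr0.
  - move=> n /andP[n0 nk]; have := Jp n; rewrite n0 leqW // => /(_ isT) Jn.
    rewrite big_ord_recl in Jn.
    case: o @m' => [j|] m' /=.
      have -> : \sum_i m' i * x (lift ord0 i) ^+ n =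
          (m ord0 * x ord0 ^+ n + \sum_i m (lift ord0 i) * x (lift ord0 i) ^+ n)
          + (x (lift ord0 j) ^+ n - x ord0 ^+ n) * m ord0.
        rewrite /m' (eq_bigr (fun i => (if j == i then m ord0 else 0) *
           x (lift ord0 i) ^+ n + m (lift ord0 i) * x (lift ord0 i) ^+ n)); last first.
          by move=> l _; rewrite (inj_eq (@Some_inj _)) mulrDl.
        rewrite big_split /= (bigD1 j) //= eqxx big1 ?addr0; last first.
          by move=> l /negPf lj; rewrite eq_sym lj mul0r.
        by ring.
      apply: zmod_setD; [by case: (adjoin_ideal (y (Some j)) hJ)|exact: adjoin_sub|].
      rewrite -[x (lift ord0 j) ^+ n - _]opprB subrXX mulNr -mulrA -mulrN.
      case: n n0 {nk Jn} => // n _.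
      have [Mz _ _] := hM; apply: adjoin_mul => //; apply: zmod_setN => //.
      rewrite -[X in M X _]addn0; apply: gradedM => //; apply: zmod_set_sum => // l _.
      have nE : n = ((n - l) + l)%N by have := ltn_ord l; lia.
      rewrite [X in M X _]nE.
      by apply: gradedM; rewrite /= -[X in M X _]mul1n; apply: gradedX.
    have -> : \sum_i m' i * x (lift ord0 i) ^+ n =
        (m ord0 * x ord0 ^+ n + \sum_i m (lift ord0 i) * x (lift ord0 i) ^+ n)
        + x ord0 * (- (m ord0 * x ord0 ^+ n.-1)).
      rewrite mulrN mulrCA -exprS prednK // addrAC subrr add0r.
      by apply: eq_bigr => l _; rewrite /m' add0r.
    apply: zmod_setD; [by case: (adjoin_ideal (x ord0) hJ)|exact: adjoin_sub|].
    case: n n0 {nk Jn} => // n _; apply: adjoin_mul => //=.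
    have [Mz _ _] := hM; apply: zmod_setN => //; rewrite -[X in M X _]add0n.
    by apply: gradedM => //; rewrite -[X in M X _]mul1n; apply: gradedX.
have [N kN] : exists N, k`! = N.+1 by exists k`!.-1; rewrite prednK // fact_gt0.
have all_adjoin o i : adjoin J (y o) N.+1 (x i ^+ N.+1).
  rewrite -kN; case: (unliftP ord0 i) => [j ->|->]; first exact: merged.
  have Mx0 : M N (x ord0 ^+ N) by rewrite -[X in M X _]mul1n; apply: gradedX.
  case: o => [j|]; last by rewrite kN exprS; apply: adjoin_mul.
  rewrite -[x ord0 ^+ _](subrK (x (lift ord0 j) ^+ k`!)).
  apply: zmod_setD; [by case: (adjoin_ideal (y (Some j)) hJ)| |exact: merged].
  rewrite kN subrXX; apply: adjoin_mul => //.
  have [Mz _ _] := hM; apply: zmod_set_sum => // l _.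
  have NE : N = ((N - l) + l)%N by have := ltn_ord l; lia.
  rewrite [X in M X _]NE.
  by apply: gradedM; rewrite /= -[X in M X _]mul1n; apply: gradedX.
(* There are k + 1 loci, and x_i^(k!) raised to the power k + 1 is x_i^((k+1)!). Multiplying the
   memberships in all the J + (y o) leaves a multiple of the product of the y o, which is shown
   below to lie in J. *)
move=> i; pose r := enum {: option 'I_k}.
have sr : size r = k.+1 by rewrite /r -cardE card_option card_ord.
have Mxi o : M N.+1 ((fun _ : option 'I_k => x i ^+ N.+1) o).
  by rewrite -[X in M X _]mul1n; apply: gradedX.
have [b Mb] := adjoin_prod r hJ My Mxi (fun o => all_adjoin o i).
rewrite sr in Mb *; rewrite big_const_seq count_predT sr iter_mulr_1 -exprM.
have -> : (N.+1 * k.+1)%N = k.+1`! by rewrite factS kN mulnC.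
move=> Jb; rewrite -[x i ^+ _](subrK ((\prod_(o <- r) y o) * b)).
apply: zmod_setD => //.
have -> : k.+1`! = (k.+1 + N * k.+1)%N by rewrite factS kN; lia.
apply: (JM) => //.
have [|u Mu uE] := mu (pred1 ord0); first by exists ord0; rewrite /= eqxx.
rewrite big_pred1_eq in uE.
pose L := [seq lift ord0 j | j <- enum 'I_k].
have sL : size L = k by rewrite size_map size_enum_ord.
(* Since L lists all indices except 0, each term with i != 0 has a zero factor. What remains is m_0
   times the product of the y o, and m_0 is invertible, being the sum over a one-element subset. *)
have := @weighted_power_sum_prod J k.+1 x L m 0 hJ Mx.
rewrite sL addn0 big_ord_recl [X in _ + X]big1 ?addr0; last first.
  move=> j _; suff -> : \prod_(j0 <- L) (x (lift ord0 j) - x j0) = 0.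
    by rewrite mulr0 mul0r.
  rewrite big_map (bigD1_seq j) //= ?subrr ?mul0r ?mem_enum ?enum_uniq //.
have -> : \prod_(o <- r) y o = (\prod_(j <- L) (x ord0 - x j)) * x ord0.
  rewrite big_enum /= (bigD1 None) //= mulrC; congr (_ * _).
  rewrite big_map big_enum /= (reindex_omap Some id) /=; last by case.
  by apply: eq_bigl => j; rewrite eqxx.
set P := \prod_(j <- L) _ => Jw.
have -> : P * x ord0 = m ord0 * P * x ord0 * u by rewrite -[LHS]mul1r -uE; ring.
rewrite -[X in J X _]addn0; apply: JM => //.
by apply: Jw => n nk; rewrite addn0; apply: Jp.
Qed.

End Nilpotency.

(** * Finiteness over the ring of power sums *)

Definition subring (R : pzRingType) (A : set R) :=
  [/\ zmod_set A, A 1 & forall x y, A x -> A y -> A (x * y)].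

Lemma subring_prod (R : pzRingType) (A : set R) I (r : seq I) (P : pred I)
    (F : I -> R) :
  subring A -> (forall i, P i -> A (F i)) -> A (\prod_(i <- r | P i) F i).
Proof. by move=> [_ A1 AM] AF; apply: big_ind. Qed.

Lemma subringX (R : pzRingType) (A : set R) x n : subring A -> A x -> A (x ^+ n).
Proof.
move=> [_ A1 AM] Ax; elim: n => [|n IH]; first by rewrite expr0.
by rewrite exprS; apply: AM.
Qed.

Section MonomialSpan.
Variables (R : comPzRingType) (A : set R) (k : nat) (x : 'I_k -> R).
Hypothesis hA : subring A.

Let mon (a : 'I_k -> nat) : R := \prod_i x i ^+ a i.

Inductive mspan (n : nat) : set R :=
| mspan_nil : mspan n 0
| mspan_cons f c a : mspan n f -> A c -> (\sum_i a i <= n)%N ->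
    mspan n (c * mon a + f).

Lemma mspanD n f g : mspan n f -> mspan n g -> mspan n (f + g).
Proof.
elim=> [|f' c a _ IH Ac an] Mg; first by rewrite add0r.
by rewrite -addrA; apply: mspan_cons => //; apply: IH.
Qed.

Lemma mspanN n f : mspan n f -> mspan n (- f).
Proof.
elim=> [|f' c a _ IH Ac an]; first by rewrite oppr0; left.
rewrite opprD -mulNr; apply: mspan_cons => //.
by apply: zmod_setN => //; case: hA.
Qed.

Lemma mspan_term n c a : A c -> (\sum_i a i <= n)%N -> mspan n (c * mon a).
Proof. by move=> Ac an; rewrite -[_ * _]addr0; apply: mspan_cons => //; left. Qed.

Lemma mspanM n l f g : mspan n f -> mspan l g -> mspan (n + l) (f * g).
Proof.
have [_ _ AM] := hA.
elim=> [|f' c a _ IH Ac an] Mg; first by rewrite mul0r; left.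
rewrite mulrDl; apply: mspanD; last exact: IH.
elim: Mg => [|g' c' a' _ IH' Ac' al]; first by rewrite mulr0; left.
rewrite mulrDr; apply: mspanD => //.
have -> : c * mon a * (c' * mon a') = c * c' * mon (fun i => a i + a' i)%N.
  rewrite mulrACA; congr (_ * _); rewrite -big_split.
  by apply: eq_bigr => i _; rewrite exprD.
by apply: mspan_term; [exact: AM|rewrite big_split leq_add].
Qed.

Lemma mspan_const n c : A c -> mspan n c.
Proof.
move=> Ac; have -> : c = c * mon (fun=> 0%N).
  by rewrite /mon big1 ?mulr1 // => i _; rewrite expr0.
by apply: mspan_term => //; rewrite big1.
Qed.

Lemma mspan_mon n a : (\sum_i a i <= n)%N -> mspan n (mon a).
Proof. by move=> an; rewrite -[mon a]mul1r; apply: mspan_term => //; case: hA. Qed.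

Lemma mspan_graded : graded mspan.
Proof.
split=> [n||]; last exact: mspanM; last by apply: mspan_const; case: hA.
by split=> [|f g Mf Mg]; [left|apply: mspanD => //; apply: mspanN].
Qed.

Lemma mspan_var i : mspan 1 (x i).
Proof.
have -> : x i = mon (fun j => j == i : nat).
  rewrite /mon (bigD1 i) //= eqxx expr1 big1 ?mulr1 // => j /negPf ->.
  by rewrite expr0.
by apply: mspan_mon; rewrite (bigD1 i) //= eqxx big1 // => j /negPf ->.
Qed.

(** Working modulo [lower] means working in the associated graded ring of [mspan]. A power sum p_n
    that lies in A has degree 0 < n, so it vanishes there, as the nilpotency lemma demands. *)
Let lower (n : nat) : set R := if n is n'.+1 then mspan n' else [set 0].

Lemma lower_ideal : graded_ideal mspan lower.
Proof.
split=> [[|n]|[|n] l f g] /=.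
- by split=> // _ _ -> ->; rewrite subrr.
- by case: mspan_graded => /(_ n).
- by move=> -> _; rewrite mul0r; case: l => // l; left.
- exact: mspanM.
Qed.

Section Box.
Variable N : nat.
Hypothesis xN : forall i, mspan N (x i ^+ N.+1).

Let box := {ffun 'I_k -> 'I_N.+1}.
Let bmon (a : box) : R := mon (fun i => a i).
Let bspan : set R :=
  [set f | exists2 c : box -> R, forall a, A (c a) & f = \sum_a c a * bmon a].

(** While some exponent exceeds N, replacing x_i^(N+1) by an element of degree at most N lowers the
    total degree. *)
Lemma mspan_bspan n f : mspan n f -> bspan f.
Proof.
have [Az A1 AM] := hA; have [A0 _] := Az.
elim/ltn_ind: n f => n IH f; elim=> [|f' c a _ [c' Ac' ->] Ac an].
  by exists (fun=> 0) => //; rewrite big1 // => a _; rewrite mul0r.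
suff [c2 Ac2 ->] : bspan (mon a).
  exists (fun a => c * c2 a + c' a).
    by move=> b; apply: zmod_setD => //; apply: AM.
  by rewrite mulr_sumr -big_split; apply: eq_bigr => b _; rewrite mulrDl mulrA.
have [aN|] := pselect (forall i, a i < N.+1)%N.
  exists (fun b => (b == [ffun i => inord (a i)])%:R).
    by move=> b; case: eqP.
  rewrite (bigD1 [ffun i => inord (a i)]) //= eqxx mul1r big1 ?addr0; last first.
    by move=> b /negPf ->; rewrite mul0r.
  by apply: eq_bigr => i _; rewrite ffunE inordK //; exact: aN.
move=> /existsNP[i /negP]; rewrite -leqNgt => Nai.
pose a' j := (if j == i then a j - N.+1 else a j)%N.
have aE : mon a = x i ^+ N.+1 * mon a'.
  rewrite /mon (bigD1 i) //= [in RHS](bigD1 i) //= /a' eqxx mulrA -exprD subnKC //.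
  by congr (_ * _); apply: eq_bigr => j /negPf ->.
have saE : (\sum_i a i = N.+1 + \sum_i a' i)%N.
  rewrite (bigD1 i) //= [in RHS](bigD1 i) //= /a' eqxx addnA subnKC //.
  by congr (_ + _)%N; apply: eq_bigr => j /negPf ->.
apply: (IH (N + \sum_i a' i)%N); first by rewrite saE in an; lia.
by rewrite aE; apply: mspanM => //; apply: mspan_mon.
Qed.

End Box.

(* The subring generated by A and the x_i is a finite A-module. *)
Lemma power_sums_finite (m : 'I_k -> R) :
    (forall i, A (m i)) ->
    (forall b : 'I_k -> bool, (exists i, b i) ->
       exists2 u, A u & u * (\sum_(i | b i) m i) = 1) ->
    (forall n, (0 < n <= k)%N -> A (\sum_i m i * x i ^+ n)) ->
  exists (I : finType) (e : I -> R) (c : 'I_k -> I -> I -> R),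
    [/\ exists i0, e i0 = 1, forall i a b, A (c i a b) &
        forall i a, x i * e a = \sum_b c i a b * e b].
Proof.
move=> Am mu Ap; have [N kN] : exists N, k`! = N.+1.
  by exists k`!.-1; rewrite prednK // fact_gt0.
(* [lower N.+1] is [mspan N], so nilpotency modulo [lower] with exponent k! = N + 1 is exactly this
   drop in degree. *)
have xN i : mspan N (x i ^+ N.+1).
  have := power_sums_nilpotent mspan_graded lower_ideal mspan_var (m := m).
  rewrite kN /=; apply=> [j|b /mu[u Au uE]|[//|n] nk] /=; try exact: mspan_const.
    by exists u => //; apply: mspan_const.
  by apply: mspan_const; apply: Ap.
pose I : finType := {ffun 'I_k -> 'I_N.+1}.
pose e (a : I) := mon (fun i => a i).
have /choice[c cP] : forall ia : 'I_k * I, exists c : I -> R,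
    (forall b, A (c b)) /\ x ia.1 * e ia.2 = \sum_b c b * e b.
  move=> ia; have [] := @mspan_bspan N xN (1 + \sum_i ia.2 i)%N (x ia.1 * e ia.2).
    by apply: mspanM; [exact: mspan_var|exact: mspan_mon].
  by move=> c Ac cE; exists c.
exists I, e, (fun i a b => c (i, a) b); split=> [|i a b|i a].
- exists [ffun=> ord0]; rewrite /e /mon big1 // => i _.
  by rewrite ffunE expr0.
- by have [] := cP (i, a).
- by have [] := cP (i, a).
Qed.

End MonomialSpan.

(** * Determinants and characteristic polynomials over rings of functions *)

Section FunctionRing.
Variables (T : Type) (R : comPzRingType) (A : set (T -> R)).
Hypothesis hA : subring A.

Lemma subring_det d (C : T -> 'M[R]_d) :
  (forall i j, A (fun t => C t i j)) -> A (fun t => \det (C t)).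
Proof.
have [Az A1 AM] := hA => AC.
have -> : (fun t => \det (C t)) =
    \sum_(s : 'S_d) (-1) ^+ s * \prod_i (fun t => C t i (s i)).
  apply: funext => t; rewrite fct_sumE; apply: eq_bigr => s _.
  by rewrite mulrfctE fct_prodE; congr (_ * _); case: (odd_perm s).
apply: zmod_set_sum => // s _; apply: AM.
  by apply: subringX => //; apply: zmod_setN.
by apply: subring_prod => // i _; apply: AC.
Qed.

End FunctionRing.

Section PolynomialFunctions.
Variables (T : Type) (K : fieldType) (A : set (T -> K)).
Hypothesis hA : subring A.

(** Elements of A[X] as families of polynomials over K; the uniform bound on the sizes makes such a
    family a single polynomial with coefficients in A. *)
Definition poly_over : set (T -> {poly K}) :=
  [set q | (exists s, forall t, (size (q t) <= s)%N) /\
           forall i, A (fun t => (q t)`_i)].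

Lemma poly_over_subring : subring poly_over.
Proof.
have [Az A1 AM] := hA; have [A0 AB] := Az; split; first split.
- by split=> [|i]; [exists 0%N => t; rewrite size_poly0|under eq_fun do rewrite coef0].
- move=> p q [[s ps] Ap] [[s' qs] Aq]; split=> [|i].
    exists (maxn s s') => t; rewrite (leq_trans (size_polyD _ _)) // size_polyN.
    by rewrite geq_max !leq_max ps qs orbT.
  by under eq_fun do rewrite coefB; apply: AB.
- split=> [|i]; first by exists 1%N => t; rewrite size_poly1.
  by under eq_fun do rewrite coef1; case: (i == 0%N).
- move=> p q [[s ps] Ap] [[s' qs] Aq]; split=> [|i].
    exists (s + s')%N => t; rewrite (leq_trans (size_polyMleq _ _)) //.
    by rewrite (leq_trans (leq_pred _)) // leq_add.
  have -> : (fun t => ((p * q) t)`_i) =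
      \sum_(j < i.+1) (fun t => (p t)`_j) * (fun t => (q t)`_(i - j)).
    by apply: funext => t; rewrite coefM fct_sumE.
  by apply: zmod_set_sum => // j _; apply: AM.
Qed.

Lemma poly_overC c : A c -> poly_over (fun t => (c t)%:P).
Proof.
have [[A0 _] _ _] := hA => Ac; split=> [|i].
  by exists 1%N => t; apply: size_polyC_leq1.
by under eq_fun do rewrite coefC; case: (i == 0%N).
Qed.

Lemma poly_overX : poly_over (fun=> 'X).
Proof.
have [[A0 _] A1 _] := hA; split=> [|i]; first by exists 2 => t; rewrite size_polyX.
by under eq_fun do rewrite coefX; case: (i == 1%N).
Qed.

Lemma matrix_over_exp d (C : T -> 'M[K]_d) n :
  (forall i j, A (fun t => C t i j)) ->
  forall i j, A (fun t => iter n (mulmx (C t)) 1%:M i j).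
Proof.
have [Az A1 AM] := hA; have [A0 _] := Az => AC; elim: n => [|n IH] i j /=.
  by under eq_fun do rewrite mxE; case: eqP.
have -> : (fun t => (C t *m iter n (mulmx (C t)) 1%:M) i j) =
   \sum_l (fun t => C t i l) * (fun t => iter n (mulmx (C t)) 1%:M l j).
  by apply: funext => t; rewrite mxE fct_sumE.
by apply: zmod_set_sum => // l _; apply: AM.
Qed.

Lemma char_poly_over d (C : T -> 'M[K]_d) :
  (forall i j, A (fun t => C t i j)) -> poly_over (fun t => char_poly (C t)).
Proof.
move=> AC; apply: (subring_det poly_over_subring) => i j.
have [Pz _ _] := poly_over_subring.
under eq_fun do rewrite !mxE.
have [_ PB] := Pz; apply: (PB (fun t => 'X *+ (i == j)) (fun t => (C t i j)%:P)).
  by case: (i == j); [exact: poly_overX|case: Pz].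
exact: poly_overC.
Qed.

End PolynomialFunctions.

(** * Lying over *)

Section LyingOver.
Variables (K : closedFieldType) (T : Type).

(** Integrality in the form used by the determinant trick. The map e lets the matrix C live on more
    points than x and v, in particular at an extra point where x has no value yet. *)
Definition eigen_integral (S : Type) (A : set (S -> K)) (e : T -> S) (x : T -> K) :=
  exists (d : nat) (C : S -> 'M[K]_d) (v : T -> 'cV[K]_d),
    [/\ forall i j, A (fun s => C s i j), forall t, v t != 0 &
        forall t, C (e t) *m v t = x t *: v t].

(* A is a ring of functions on T together with one further point None; the
   further point satisfies every relation that holds on T, i.e. it defines a
   homomorphism to K from the ring of restrictions of A to T. *)
Definition extra_point (A : set (option T -> K)) :=
  [/\ subring A, forall c, A (fun=> c) &
      forall f, A f -> (forall t, f (Some t) = 0) -> f None = 0].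

Section OneStep.
Variables (A : set (option T -> K)) (x : T -> K).
Hypothesis hA : extra_point A.
Hypothesis hx : eigen_integral A Some x.

(** The constraints on a value of x at the extra point: they form an ideal of K[X], since the
    coefficients at [None] are scalars. *)
Let vanishing : set {poly K} :=
  [set p | exists q, [/\ poly_over A q, forall t, (q (Some t)).[x t] = 0 &
                         p = q None]].

Let vanishingM p r : vanishing p -> vanishing (p * r).
Proof.
have [Ar Ac _] := hA; move=> [q [Aq q0 ->]]; exists (q * (fun=> r)); split=> //.
  have [_ _ PM] := poly_over_subring Ar; apply: PM => //.
  by split=> [|i]; [exists (size r)|apply: Ac].
by move=> t; rewrite hornerM q0 mul0r.
Qed.

Let vanishingB p r : vanishing p -> vanishing r -> vanishing (p - r).
Proof.
have [Ar Ac _] := hA; move=> [q [Aq q0 ->]] [q' [Aq' q0' ->]].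
exists (q - q'); split=> //.
  by have [[_ PB] _ _] := poly_over_subring Ar; apply: PB.
by move=> t; rewrite hornerD hornerN q0 q0' subr0.
Qed.

(* Determinant trick: if q annihilates x and q = 1 at the extra point, then the
   function det q(C) vanishes on T and equals 1 at the extra point. *)
Let vanishing_proper : ~ vanishing 1.
Proof.
have [Ar Ac A0] := hA; move=> [q [[[s qs] Aq] q0 q1]].
have [d [C [v [AC v0 Cv]]]] := hx.
pose P o := \sum_(i < s) (q o)`_i *: iter i (mulmx (C o)) 1%:M.
have AP : A (fun o => \det (P o)).
  apply: subring_det => // i j.
  have -> : (fun o => P o i j) = \sum_(l < s) (fun o => (q o)`_l) *
      (fun o => iter l (mulmx (C o)) 1%:M i j).
    apply: funext => o; rewrite summxE fct_sumE.
    by apply: eq_bigr => l _; rewrite mxE.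
  have [Az _ AM] := Ar.
  by apply: zmod_set_sum => // l _; apply: AM => //; apply: matrix_over_exp.
have := A0 _ AP; have -> : P None = 1%:M.
  rewrite /P -q1; have := qs None; rewrite -q1 size_poly1.
  case: s {P AP qs} => // s _; rewrite big_ord_recl coef1 /= scale1r big1 ?addr0 //.
  by move=> i _; rewrite coef1 /= scale0r.
rewrite det1 => /(_ _)/eqP; rewrite oner_eq0 => H; apply/notF/H => t.
have iterE i : iter i (mulmx (C (Some t))) 1%:M *m v t = x t ^+ i *: v t.
  elim: i => [|i IH] /=; first by rewrite mul1mx expr0 scale1r.
  by rewrite -mulmxA IH -scalemxAr Cv scalerA exprSr.
(* The vector v t lies in the kernel of P (Some t), because q annihilates the eigenvalue x t. *)
apply/eqP; rewrite -det_tr; apply/det0P; exists (v t)^T.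
  by apply: contraNneq (v0 t) => vT; rewrite -[v t]trmxK vT trmx0.
rewrite -trmx_mul mulmx_suml (eq_bigr (fun i : 'I_s =>
  ((q (Some t))`_i * x t ^+ i) *: v t)).
  by rewrite -scaler_suml -(horner_coef_wide _ (qs _)) q0 scale0r trmx0.
by move=> i _; rewrite -scalemxAl iterE scalerA.
Qed.

(** A nonzero element g of minimal size generates the ideal. By properness g is not constant, so it
    has a root in the algebraically closed field K. If the ideal is zero, any value will do. *)
Let vanishing_root : exists a, forall p, vanishing p -> p.[a] = 0.
Proof.
have [nz|z] := pselect (exists2 p, vanishing p & p != 0); last first.
  exists 0 => p vp; case: (eqVneq p 0) => [->|p0]; first by rewrite horner0.
  by case: z; exists p.
have exg : exists n, `[< exists p, [/\ vanishing p, p != 0 & size p = n] >].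
  by case: nz => p vp p0; exists (size p); apply/asboolP; exists p.
case: (ex_minnP exg) => n /asboolP[g [vg g0 sg]] nmin.
have dvd p : vanishing p -> g %| p.
  move=> vp; apply/eqP; apply/eqP; apply: contraT => r0.
  have : (n <= size (p %% g)%R)%N.
    apply: nmin; apply/asboolP; exists (p %% g); split=> //.
    have -> : p %% g = p - g * (p %/ g) by rewrite {2}(divp_eq p g); ring.
    by apply: vanishingB => //; apply: vanishingM.
  by rewrite leqNgt -sg ltn_modp g0.
have [/closed_rootP[a /eqP ga]|] := boolP (size g != 1).
  by exists a => p /dvd/dvdpP[r ->]; rewrite hornerM ga mulr0.
rewrite negbK => /size_poly1P[c c0 gc]; case: vanishing_proper.
have -> : 1 = g * c^-1%:P by rewrite gc -polyCM divff.
exact: vanishingM.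
Qed.

(** A' is A[x], where x takes a common root a of [vanishing] as its value at [None]; by the choice
    of a, the relations that x satisfies on T persist there. *)
Lemma extra_point_extend :
  exists (a : K) (A' : set (option T -> K)),
    [/\ extra_point A', forall f, A f -> A' f & A' (oapp x a)].
Proof.
have [Ar Ac A0] := hA; have [a va] := vanishing_root.
have [[P0 PB] P1 PM] := poly_over_subring Ar.
exists a, [set f | exists2 q, poly_over A q &
                   f = fun o => (q o).[oapp x a o]]%classic; split.
- split; first split; first split.
  + by exists 0 => //; apply: funext => o; rewrite horner0.
  + move=> _ _ [p Pp ->] [q Pq ->]; exists (p - q); first exact: PB.
    by apply: funext => o; rewrite hornerD hornerN.
  + by exists 1 => //; apply: funext => o; rewrite hornerC.
  + move=> _ _ [p Pp ->] [q Pq ->]; exists (p * q); first exact: PM.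
    by apply: funext => o; rewrite hornerM.
  + move=> c; exists (fun=> c%:P); last by apply: funext => o; rewrite hornerC.
    by apply: (poly_overC Ar (c := fun=> c)).
  + by move=> _ [q Pq ->] q0; apply: va; exists q.
- move=> f Af; exists (fun o => (f o)%:P); first exact: poly_overC.
  by apply: funext => o; rewrite hornerC.
- exists (fun=> 'X); first exact: poly_overX.
  by apply: funext => o; rewrite hornerX.
Qed.

End OneStep.

Lemma extra_point_extend_seq (I : eqType) (s : seq I) (x : I -> T -> K)
    (A : set (option T -> K)) :
    extra_point A -> (forall i, eigen_integral A Some (x i)) ->
  exists (a : I -> K) (A' : set (option T -> K)),
    [/\ extra_point A', forall f, A f -> A' f &
        forall i, i \in s -> A' (oapp (x i) (a i))].
Proof.
move=> hA hx; elim: s => [|i s [a [A' [hA' AA' A'x]]]].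
  by exists (fun=> 0), A; split.
have [b [A2 [hA2 A'A2 A2x]]] : exists (a : K) (A2 : set (option T -> K)),
    [/\ extra_point A2, forall f, A' f -> A2 f & A2 (oapp (x i) a)].
  apply: extra_point_extend => //; have [d [C [v [AC v0 Cv]]]] := hx i.
  by exists d, C, v; split=> // *; apply: AA'.
exists (fun j => if j == i then b else a j), A2; split=> // [f /AA'/A'A2 //|j].
rewrite inE; case: eqP => [-> _ //|_ /= js]; by apply/A'A2/A'x.
Qed.

End LyingOver.

(** * Affine varieties *)

Lemma sval_inj (T : Type) (P : T -> Prop) (u v : {x | P x}) : sval u = sval v -> u = v.
Proof. by case: u v => [a Pa] [b Pb] /= ab; apply: eq_exist. Qed.

Definition subalgebra (T : Type) (K : fieldType) (A : set (T -> K)) :=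
  subring A /\ forall c, A (fun=> c).

Section Generated.
Variables (T : Type) (K : fieldType).

Inductive generated (S : set (T -> K)) : set (T -> K) :=
| generated_const c : generated S (fun=> c)
| generated_incl f : S f -> generated S f
| generated_add f g : generated S f -> generated S g ->
    generated S (fun t => f t + g t)
| generated_mul f g : generated S f -> generated S g ->
    generated S (fun t => f t * g t).

Lemma generated_subalgebra S : subalgebra (generated S).
Proof.
split; last exact: generated_const.
split; [split| |]; try exact: generated_const; last exact: generated_mul.
move=> f g Sf Sg.
have -> : f - g = fun t => f t + (-1) * g t by apply: funext => t; rewrite mulN1r.
by apply: generated_add => //; apply: generated_mul => //; apply: generated_const.
Qed.

Lemma generated_min (T' : Type) (S : set (T -> K)) (A : set (T' -> K)) (e : T' -> T) f :
  subalgebra A -> (forall g, S g -> A (g \o e)) -> generated S f -> A (f \o e).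
Proof.
move=> [[Az _ AM] Ac] SA; elim=> [c|g /SA //|g h _ Ag _ Ah|g h _ Ag _ Ah].
- exact: Ac.
- exact: zmod_setD Ag Ah.
- exact: AM Ag Ah.
Qed.

Lemma subalgebra_meval (A : set (T -> K)) n (b : 'I_n -> T -> K) (p : {mpoly K[n]}) :
  subalgebra A -> (forall i, A (b i)) -> A (fun t => p.@[fun i => b i t]).
Proof.
move=> [Ar Ac] Ab; have [Az _ AM] := Ar.
have -> : (fun t => p.@[fun i => b i t]) =
    \sum_(m <- msupp p) (fun=> p@_m) * \prod_i b i ^+ m i.
  apply: funext => t; rewrite mevalE fct_sumE; apply: eq_bigr => m _.
  rewrite mulrfctE fct_prodE; congr (_ * _).
  by apply: eq_bigr => i _; rewrite exprfctE.
apply: zmod_set_sum => // m _; apply: AM => //.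
by apply: subring_prod => // i _; apply: subringX.
Qed.

Lemma generated_mpoly n (b : 'I_n -> T -> K) f :
  generated (range b) f -> exists p : {mpoly K[n]}, f = fun t => p.@[fun i => b i t].
Proof.
elim=> [c|g [i _ <-]|g h _ [p ->] _ [q ->]|g h _ [p ->] _ [q ->]].
- by exists c%:MP; apply: funext => t; rewrite mevalC.
- by exists 'X_i; apply: funext => t; rewrite mevalXU.
- by exists (p + q); apply: funext => t; rewrite mevalD.
- by exists (p * q); apply: funext => t; rewrite mevalM.
Qed.

End Generated.

Section AffineVarieties.
Variable K : closedFieldType.

(** A closed embedding into affine n-space with image the zero locus of I, phrased through functions
    on X so that neither subtypes nor an inverse morphism appear. *)
Record coordinates (X : fspace K) (n : nat) (I : set {mpoly K[n]})
    (x : 'I_n -> X -> K) : Prop := Coordinates {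
  coord_regular : forall h, regular X h <->
    exists p : {mpoly K[n]}, h = fun y => p.@[fun i => x i y];
  coord_inj : forall y y', (forall i, x i y = x i y') -> y = y';
  coord_zero : forall p y, I p -> p.@[fun i => x i y] = 0;
  coord_onto : forall z : 'I_n -> K, (forall p, I p -> p.@[z] = 0) ->
    exists y, forall i, x i y = z i }.

Lemma affine_coordinates (X : affvar K) :
  exists (n : nat) (I : set {mpoly K[n]}) (x : 'I_n -> X -> K), coordinates I x.
Proof.
have [n [I [f [g [fK gK]]]]] := affvar_affine X.
exists n, I, (fun i y => (sval (f y) : 'I_n -> K) i); split.
- move=> h; split=> [rh|[p ->]].
    have [g0 [p gE] hg] := mor_regular g rh.
    by exists p; apply: funext => y; rewrite -gE -hg /= fK.
  apply: (mor_regular f (g := fun z => p.@[sval z])).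
  by exists (fun z => p.@[z]) => //; exists p.
- move=> y y' yy'; rewrite -[y]fK -[y']fK; congr (g _).
  by apply: sval_inj; apply: funext.
- by move=> p y Ip; apply: (svalP (f y)).
- move=> z zI; exists (g (exist _ z zI)) => i; by rewrite gK.
Qed.

Lemma coordinates_affine (X : fspace K) n (I : set {mpoly K[n]}) x :
  @coordinates X n I x -> is_affine X.
Proof.
move=> [xr xi x0 xo].
have fP y : zero_locus I (fun i => x i y) by move=> p; apply: x0.
pose f0 y : {z | zero_locus I z} := exist _ _ (fP y).
have f_reg h : regular (subspace (zero_locus I)) h -> regular X (h \o f0).
  move=> [h0 [p pE] hE]; apply/xr; exists p; apply: funext => y.
  by rewrite /= hE pE.
have gP (z : {z | zero_locus I z}) : exists y, forall i, x i y = sval z i.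
  by apply: xo; apply: (svalP z).
have [g0 g0P] := choice gP.
have g_reg h : regular X h -> regular (subspace (zero_locus I)) (h \o g0).
  move=> /xr[p ->]; exists (fun z => p.@[z]); first by exists p.
  move=> z /=; congr (p.@[_]); apply: funext => i; exact: g0P.
exists n, I, (Mor f_reg), (Mor g_reg); split=> [y|z] /=.
  by apply: xi => i; rewrite g0P.
by apply: sval_inj; apply: funext => i; rewrite /= g0P.
Qed.

Lemma regular_subalgebra (X : affvar K) : subalgebra (regular X).
Proof.
have [n [I [x [xr _ _ _]]]] := affine_coordinates X; split; first split.
- split; first by apply/xr; exists 0; apply: funext => y; rewrite meval0.
  move=> _ _ /xr[p ->] /xr[q ->]; apply/xr; exists (p - q).
  by apply: funext => y; rewrite mevalB.
- by apply/xr; exists 1; apply: funext => y; rewrite meval1.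
- move=> _ _ /xr[p ->] /xr[q ->]; apply/xr; exists (p * q).
  by apply: funext => y; rewrite mevalM.
- by move=> c; apply/xr; exists c%:MP; apply: funext => y; rewrite mevalC.
Qed.

(** Lagrange interpolation: the coordinates separate points, and rescaling a difference gives a
    regular e with e(y) = 1 and e(z) = 0. *)
Lemma regular_interpolation (X : affvar K) (h : X -> K) (s : seq {classic X}) :
  exists2 g, regular X g & forall y, y \in s -> g y = h y.
Proof.
have [Xr Xc] := regular_subalgebra X; have [Xz X1 XM] := Xr.
have sep (y z : {classic X}) : exists2 e, regular X e & y != z -> e y = 1 /\ e z = 0.
  have [->|yz] := eqVneq y z; first by exists (fun=> 0) => //; rewrite eqxx.
  have [n [I [x [xr xi _ _]]]] := affine_coordinates X.
  have [i /eqP xiyz] : exists i, x i y <> x i z.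
    by apply/existsNP => xyz; case/eqP: yz; apply: xi.
  exists ((x i - (fun=> x i z)) * (fun=> (x i y - x i z)^-1)).
    apply: XM => //; case: Xz => _; apply=> //.
    by apply/xr; exists 'X_i; apply: funext => w; rewrite mevalXU.
  move=> _; rewrite !mulrfctE /= !addrfctE /= !opprfctE subrr mul0r mulfV //.
  by rewrite subr_eq0.
elim: s => [|y s [g rg gs]]; first by exists (fun=> 0).
have [ys|ys] := boolP (y \in s).
  by exists g => // z; rewrite inE => /orP[/eqP->|]; apply: gs.
have [e eP] := choice (fun z => let: ex_intro2 e re he := sep y z in
  ex_intro (fun e => regular X e /\ (y != z -> e y = 1 /\ e z = 0)) e (conj re he)).
exists (g + (fun=> h y - g y) * \prod_(z <- s) e z).
  apply: zmod_setD => //; apply: XM => //.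
  by apply: subring_prod => // z _; case: (eP z).
move=> z; rewrite addrfctE mulrfctE /= fct_prodE inE => /orP[/eqP->|zs].
  rewrite big_seq big1 ?mulr1 1?addrC ?subrK // => w ws.
  by have [_ /(_ _)[]] := eP w => //; apply: contraNneq ys => ->.
rewrite (perm_big _ (perm_to_rem zs)) big_cons.
have [_ /(_ _)[|_ ->]] := eP z; first by apply: contraNneq ys => ->.
by rewrite /= mul0r mulr0 addr0 gs.
Qed.

(** Only finitely many points occur, so h may be replaced by a regular function with the same values
    at them. *)
Lemma regular_eq_functional (X : affvar K) k k' (m : 'I_k -> K) (m' : 'I_k' -> K)
    (y : 'I_k -> X) (y' : 'I_k' -> X) :
  (forall h, regular X h -> \sum_i m i * h (y i) = \sum_i m' i * h (y' i)) ->
  forall h : X -> K, \sum_i m i * h (y i) = \sum_i m' i * h (y' i).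
Proof.
move=> reg_eq h; pose s : seq {classic X} := codom y ++ codom y'.
have [g rg gs] := regular_interpolation h s.
have gy i : g (y i) = h (y i) by apply: gs; rewrite mem_cat codom_f.
have gy' i : g (y' i) = h (y' i) by apply: gs; rewrite mem_cat codom_f orbT.
have := reg_eq _ rg.
under eq_bigr do rewrite gy; under [in X in _ = X -> _]eq_bigr do rewrite gy'.
exact.
Qed.

End AffineVarieties.

(** * Integrality of the points over the ring of power sums *)

Section PowerSumsIntegral.
Variables (K : closedFieldType) (T : Type) (A : set (T -> K)).
Variables (k : nat) (m x : 'I_k -> T -> K).
Hypotheses (hA : subring A) (Am : forall i, A (m i)).
Hypothesis mu : forall b : 'I_k -> bool, (exists i, b i) ->
  exists2 u, A u & u * (\sum_(i | b i) m i) = 1.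
Hypothesis Ap : forall n, (0 < n <= k)%N -> A (\sum_i m i * x i ^+ n).

(** The module generators evaluated at t form the eigenvector, which is nonzero because one
    generator is 1. *)
Lemma power_sums_eigen :
  exists (d : nat) (C : 'I_k -> T -> 'M[K]_d) (v : T -> 'cV[K]_d),
    [/\ forall l i j, A (fun t => C l t i j), forall t, v t != 0 &
        forall l t, C l t *m v t = x l t *: v t].
Proof.
have [I [e [c [[i0 ei0] Ac cE]]]] := power_sums_finite hA Am mu Ap.
exists #|I|, (fun l t => \matrix_(i, j) c l (enum_val i) (enum_val j) t),
  (fun t => \col_i e (enum_val i) t); split=> [l i j|t|l t].
- have -> : (fun t => (\matrix_(i, j) c l (enum_val i) (enum_val j) t) i j) =
      c l (enum_val i) (enum_val j) by apply: funext => t; rewrite mxE.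
  exact: Ac.
- apply/negP => /eqP/matrixP/(_ (enum_rank i0) ord0); rewrite !mxE enum_rankK ei0.
  by move/eqP; rewrite oner_eq0.
- apply/matrixP => i j; rewrite !mxE.
  have := congr1 (fun f => f t) (cE l (enum_val i)).
  rewrite fct_sumE mulrfctE => ->.
  rewrite [RHS](reindex_onto enum_val enum_rank) /=; last first.
    by move=> b _; rewrite enum_rankK.
  by apply: eq_big => [b|b _]; rewrite ?enum_valK ?eqxx // !mxE.
Qed.

(* The product of the characteristic polynomials annihilates all the x_i. *)
Lemma power_sums_monic :
  exists (d : nat) (c : 'I_d -> T -> K), (forall l, A (c l)) /\
    forall i t, x i t ^+ d = \sum_l c l t * x i t ^+ l.
Proof.
have [d [C [v [AC v0 Cv]]]] := power_sums_eigen.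
(* The transposes are there because [eigenvalue] refers to row vectors. *)
pose F t := \prod_i char_poly (C i t)^T.
have AF : poly_over A F.
  have -> : F = \prod_i (fun t => char_poly (C i t)^T) by rewrite fct_prodE.
  apply: subring_prod => [|i _]; first exact: poly_over_subring.
  apply: char_poly_over => // a b.
  by under eq_fun do rewrite mxE.
have Fmonic t : F t \is monic by apply: monic_prod => i _; apply: char_poly_monic.
have sF t : size (F t) = (d * k).+1.
  rewrite /F -[in RHS](card_ord k) cardE -big_enum; elim: (enum _) => [|i s IH].
    by rewrite big_nil size_poly1 muln0.
  rewrite big_cons size_monicM ?char_poly_monic //.
    by rewrite size_char_poly IH addSn addnS mulnS.
  by rewrite -size_poly_gt0 IH.
have Fx i t : (F t).[x i t] = 0.
  rewrite horner_prod (bigD1 i) //=.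
  suff /eqP -> : root (char_poly (C i t)^T) (x i t) by rewrite mul0r.
  rewrite -eigenvalue_root_char; apply/eigenvalueP; exists (v t)^T.
    by rewrite -trmx_mul Cv linearZ.
  by apply: contraNneq (v0 t) => vT; rewrite -[v t]trmxK vT trmx0.
exists (d * k)%N, (fun l t => - (F t)`_l); split=> [l|i t].
  by case: AF => _ /(_ l); apply: zmod_setN; case: hA.
have := Fx i t; rewrite horner_coef sF big_ord_recr /=.
have -> : (F t)`_(d * k) = 1 by have /monicP := Fmonic t; rewrite /lead_coef sF.
rewrite mul1r addrC => /eqP; rewrite addr_eq0 => /eqP ->.
by rewrite -sumrN; apply: eq_bigr => l _; rewrite mulNr.
Qed.

End PowerSumsIntegral.

(** * Cycles with coefficients in the field *)

Section WeightedCycles.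
Variables (K : closedFieldType) (k : nat).

(* The cycle \sum_i m_i x_i with coefficients in K, as a linear form on all
   functions: its values at indicator functions are the multiplicities. *)
Definition weighted (X : Type) (m : 'I_k -> K) (x : 'I_k -> X) : (X -> K) -> K :=
  fun h => \sum_i m i * h (x i).

(** The weights are kept as part of the point, so the map to the base is a projection. The points
    x_i enter only through the form, which identifies tuples giving the same cycle. *)
Definition cycles (X : Type) : Type :=
  {z : punctured K k * ((X -> K) -> K) | exists x, z.2 = weighted (sval z.1) x}.

Definition cycle_gens (X : fspace K) : set (cycles X -> K) :=
  [set f | (exists2 a, regular (punctured K k) a & f = fun z => a (sval z).1) \/
           (exists2 h, regular X h & f = fun z => (sval z).2 h)].

Definition cycle_space (X : fspace K) : fspace K :=
  @Fspace K (cycles X) (generated (@cycle_gens X)).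

Definition mk_cycle (X : Type) (t : punctured K k * ('I_k -> X)) : cycles X :=
  exist _ (t.1, weighted (sval t.1) t.2) (ex_intro _ t.2 erefl).

Lemma mk_cycle_surj (X : Type) (z : cycles X) : exists t, z = mk_cycle t.
Proof.
case: z => [[m L] [x /= LE]]; exists (m, x); apply: sval_inj => /=.
by rewrite LE.
Qed.

Definition disc (m : 'I_k -> K) : K :=
  \prod_(S : {set 'I_k} | S != finset.set0) \sum_(i in S) m i.

Lemma disc_neq0 (m : punctured K k) : disc (sval m) != 0.
Proof. by apply/prodf_neq0 => S S0; apply: (svalP m). Qed.

(** * Finite generation and affineness of the space of cycles *)

Section Affine.
Variables (X : affvar K) (n : nat) (I : set {mpoly K[n]}) (x : 'I_n -> X -> K).
Hypothesis hx : coordinates I x.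

Let T : Type := (punctured K k * ('I_k -> X))%type.
Let mu (i : 'I_k) (t : T) : K := sval t.1 i.
Let dinv (t : T) : K := (disc (sval t.1))^-1.
Let psum (h : X -> K) (t : T) : K := \sum_i mu i t * h (t.2 i).
Let xi (i : 'I_k) (j : 'I_n) (t : T) : K := x j (t.2 i).

(** Generators of the base of the finite extension: exponents up to k are what the nilpotency
    argument asks for, and [dinv] makes the partial sums of weights invertible. *)
Let base_gens : set (T -> K) :=
  [set f | [\/ exists i, f = mu i, f = dinv |
    exists l j, (0 < l <= k)%N /\ f = psum (fun y => x j y ^+ l)]].

Let A0 := generated base_gens.

Let A0_subring : subring A0. Proof. by case: (generated_subalgebra base_gens). Qed.

Let A0_mu i : A0 (mu i).
Proof. by apply: generated_incl; apply: Or31; exists i. Qed.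

(** A partial sum is one factor of [disc]; its inverse is the product of the other factors divided
    by [disc]. *)
Let A0_unit (b : 'I_k -> bool) : (exists i, b i) ->
  exists2 u, A0 u & u * (\sum_(i | b i) mu i) = 1.
Proof.
move=> [i0 bi0]; pose S0 := [set i | b i]%SET.
have S00 : S0 != finset.set0 by apply/set0Pn; exists i0; rewrite inE.
have [Az A1 AM] := A0_subring.
exists ((\prod_(S : {set 'I_k} | (S != finset.set0) && (S != S0))
          \sum_(i in S) mu i) * dinv).
  apply: AM; last by apply: generated_incl; apply: Or32.
  by apply: subring_prod => // S _; apply: zmod_set_sum.
apply: funext => t; rewrite !mulrfctE fct_prodE fct_sumE.
rewrite mulrAC; have -> : \sum_(i | b i) mu i t = \sum_(i in S0) sval t.1 i.
  by apply: eq_bigl => i; rewrite inE.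
rewrite [X in X * dinv t](_ : _ = disc (sval t.1)) ?mulfV ?disc_neq0 //.
rewrite /disc [in RHS](bigD1 S0) //= mulrC; congr (_ * _).
by apply: eq_bigr => S _; rewrite fct_sumE.
Qed.

Let A0_psum j l : (0 < l <= k)%N -> A0 (\sum_i mu i * xi i j ^+ l).
Proof.
move=> lk; apply: generated_incl; apply: Or33; exists l, j; split=> //.
by apply: funext => t; rewrite fct_sumE; apply: eq_bigr => i _; rewrite mulrfctE exprfctE.
Qed.

Section Box.
Variable N : nat.
Hypothesis kN : (k < N.+1)%N.

(** Three kinds of generators: the weights, the inverse of [disc], and the power sums of the
    monomials with all exponents at most N. *)
Definition gen_index : finType := ('I_k + unit + {ffun 'I_n -> 'I_N.+1})%type.

Let gen (e : gen_index) (z : cycles X) : K :=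
  match e with
  | inl (inl i) => sval (sval z).1 i
  | inl (inr _) => (disc (sval (sval z).1))^-1
  | inr a => (sval z).2 (fun y => \prod_j x j y ^+ a j)
  end.

Let genT (i : 'I_#|gen_index|) (t : T) : K := gen (enum_val i) (mk_cycle t).

Let AN := generated (range genT).

Let AN_gen e : AN (fun t => gen e (mk_cycle t)).
Proof.
apply: generated_incl; exists (enum_rank e) => //.
by apply: funext => t; rewrite /genT enum_rankK.
Qed.

Let A0_AN f : A0 f -> AN f.
Proof.
apply: (generated_min (e := id)); first exact: generated_subalgebra.
move=> _ [[i ->]|->|[l [j [/andP[_ lk] ->]]]].
- exact: AN_gen (inl (inl i)).
- exact: AN_gen (inl (inr tt)).
pose a : {ffun 'I_n -> 'I_N.+1} := [ffun j' => if j' == j then inord l else ord0].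
have := AN_gen (inr a); congr AN; apply: funext => t /=.
apply: eq_bigr => i _; congr (_ * _); rewrite (bigD1 j) //= ffunE eqxx.
rewrite inordK ?(leq_ltn_trans lk) // big1 ?mulr1 // => j' /negPf j'j.
by rewrite ffunE j'j expr0.
Qed.

Let reducible := forall j, exists (d : nat) (c : 'I_d -> T -> K),
  [/\ (d <= N.+1)%N, forall l, A0 (c l) &
      forall i t, xi i j t ^+ d = \sum_l c l t * xi i j t ^+ l].
Hypothesis red : reducible.

(** The coefficients of the monic equation for x_j are the same at all k points, so they come out of
    the sum over i: a power sum with a large exponent is a combination over A0 of power sums of
    smaller total degree. *)
Let AN_mon (a : 'I_n -> nat) : AN (psum (fun y => \prod_j x j y ^+ a j)).
Proof.
have [[Az A1 AM] Ac] := generated_subalgebra (range genT).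
move: {2}(\sum_j a j)%N (leqnn (\sum_j a j)) => s.
elim/ltn_ind: s a => s IH a sa.
have [aN|] := pselect (forall j, a j < N.+1)%N.
  have := AN_gen (inr [ffun j => inord (a j)]); congr AN; apply: funext => t /=.
  apply: eq_bigr => i _; congr (_ * _); apply: eq_bigr => j _.
  by rewrite ffunE inordK.
move=> /existsNP[j /negP]; rewrite -leqNgt => Naj.
have [d [c [dN Ac0 cE]]] := red j.
pose a' (l : nat) j' := (if j' == j then a j - d + l else a j')%N.
have -> : psum (fun y => \prod_j x j y ^+ a j) =
    \sum_l c l * psum (fun y => \prod_j x j y ^+ a' l j).
  apply: funext => t; rewrite fct_sumE.
  under [RHS]eq_bigr do rewrite mulrfctE mulr_sumr.
  rewrite exchange_big; apply: eq_bigr => i _ /=.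
  have monE b : \prod_j0 x j0 (t.2 i) ^+ b j0 =
      xi i j t ^+ b j * \prod_(j0 | j0 != j) x j0 (t.2 i) ^+ b j0.
    by rewrite (bigD1 j).
  rewrite monE -(subnK (leq_trans dN Naj)) exprD cE.
  set R := \prod_(j0 | _) _; set e := xi i j t ^+ _.
  rewrite (_ : _ * (e * _ * R) = (\sum_l c l t * xi i j t ^+ l) * (mu i t * e * R));
    last by ring.
  rewrite mulr_suml; apply: eq_bigr => l _.
  rewrite monE {1}/a' eqxx exprD.
  rewrite [\prod_(j0 | j0 != j) _](_ : _ = R); first by rewrite /e; ring.
  by apply: eq_bigr => j' /negPf j'j; rewrite /a' j'j.
apply: zmod_set_sum => // l _; apply: AM; first exact: A0_AN.
apply: (IH (\sum_j a' l j)%N) => //; apply: leq_trans sa.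
rewrite (bigD1 j) //= [X in (_ < X)%N](bigD1 j) //= {1}/a' eqxx.
rewrite (eq_bigr a); last by move=> j' /negPf j'j; rewrite /a' j'j.
by have := ltn_ord l; lia.
Qed.

Let AN_psum h : regular X h -> AN (psum h).
Proof.
have [[Az A1 AM] Ac] := generated_subalgebra (range genT).
move=> /(coord_regular hx)[p ->].
have -> : psum (fun y => p.@[fun i => x i y]) =
   \sum_(e <- msupp p) (fun=> p@_e) * psum (fun y => \prod_j x j y ^+ e j).
  apply: funext => t; rewrite fct_sumE /psum.
  under [RHS]eq_bigr do rewrite mulrfctE mulr_sumr.
  rewrite exchange_big; apply: eq_bigr => i _ /=.
  by rewrite mevalE mulr_sumr; apply: eq_bigr => e _; ring.
apply: zmod_set_sum => // e _; apply: AM; [exact: Ac|exact: AN_mon].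
Qed.

Let AN_regular f : regular (cycle_space X) f -> AN (f \o @mk_cycle X).
Proof.
have AN_alg := generated_subalgebra (range genT).
have [[_ _ AM] Ac] := AN_alg.
apply: generated_min => // _ [[a [p [s aE]] ->]|[h rh ->]]; last exact: AN_psum.
have -> : (fun z : cycles X => a (sval z).1) \o @mk_cycle X =
    (fun t => p.@[fun i => mu i t]) * dinv ^+ s.
  apply: funext => t; rewrite mulrfctE exprfctE /= aE exprVn.
  by [].
apply: AM.
  by apply: subalgebra_meval => // i; apply: AN_gen (inl (inl i)).
by apply: subringX; [case: AN_alg|apply: AN_gen (inl (inr tt))].
Qed.

Let regular_gen e : regular (cycle_space X) (gen e).
Proof.
case: e => [[i|[]]|a]; apply: generated_incl.
- left; exists (fun m => sval m i) => //; exists 'X_i, 0%N => m.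
  by rewrite mevalXU expr0 divr1.
- left; exists (fun m => (disc (sval m))^-1) => //; exists 1, 1%N => m.
  by rewrite meval1 mul1r expr1.
right; exists (fun y => \prod_j x j y ^+ a j) => //; apply/(coord_regular hx).
exists (\prod_j 'X_j ^+ a j); apply: funext => y.
rewrite rmorph_prod; apply: eq_bigr => j _.
by rewrite /= rmorphXn /= mevalXU.
Qed.

Let gen_inj z z' : (forall e, gen e z = gen e z') -> z = z'.
Proof.
have [t ->] := mk_cycle_surj z; have [t' ->] := mk_cycle_surj z' => tt'.
have AN_eq f : AN f -> (forall e, gen e (mk_cycle t) = gen e (mk_cycle t')) -> f t = f t'.
  move=> /generated_mpoly[p ->] eqg; congr (p.@[_]); apply: funext => i; exact: eqg.
have m_eq : t.1 = t'.1.
  by apply: sval_inj; apply: funext => i; apply: (tt' (inl (inl i))).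
apply: sval_inj => /=; congr (_, _) => //; apply: funext.
by apply: regular_eq_functional => h rh; apply: (AN_eq (psum h)) => //; apply: AN_psum.
Qed.

Let xi_integral i j : eigen_integral AN id (xi i j).
Proof.
have [d [C [v [AC v0 Cv]]]] :=
  @power_sums_eigen K T A0 k mu (xi^~ j) A0_subring A0_mu A0_unit (A0_psum j).
by exists d, (C i), v; split=> // *; apply: A0_AN.
Qed.

(** A solution z of all relations between the generators is an extra point of T. Lying over gives it
    values of the coordinates of k points, and relations holding on T then show that the resulting
    cycle has generator values z. *)
Let gen_closed (z : 'I_#|gen_index| -> K) :
  (forall p : {mpoly K[#|gen_index|]},
     (forall w, p.@[fun e => gen (enum_val e) w] = 0) -> p.@[z] = 0) ->
  exists w, forall e, gen (enum_val e) w = z e.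
Proof.
move=> zP; pose gz e : option T -> K := oapp (genT e) (z e).
pose B := generated (range gz).
have Bgz e : B (gz e) by apply: generated_incl; exists e.
have B_extra : extra_point B.
  have [Br Bc] := generated_subalgebra (range gz); split=> //.
  move=> _ /generated_mpoly[p ->] p0; apply: zP => w.
  by have [t ->] := mk_cycle_surj w; apply: p0.
have lift f : AN f -> exists2 g, B g & forall t, g (Some t) = f t.
  move=> /generated_mpoly[p ->]; exists (fun o => p.@[fun e => gz e o]) => //.
  by apply: subalgebra_meval => //; apply: generated_subalgebra.
have xi_B (ij : 'I_k * 'I_n) : eigen_integral B Some (xi ij.1 ij.2).
  have [d [C [v [AC v0 Cv]]]] := xi_integral ij.1 ij.2.
  have liftC (ab : 'I_d * 'I_d) : exists g,
      B g /\ forall t, g (Some t) = C t ab.1 ab.2.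
    by have [g Bg gE] := lift _ (AC ab.1 ab.2); exists g.
  have [C' C'P] := choice liftC.
  exists d, (fun o => \matrix_(a, b) C' (a, b) o), v; split=> // [a b|t].
    by under eq_fun do rewrite mxE; case: (C'P (a, b)).
  rewrite -Cv; congr (_ *m _); apply/matrixP => a b; rewrite mxE.
  by have [_ ->] := C'P (a, b).
have [al [B' [B'_extra BB' B'xi]]] := extra_point_extend_seq
  (enum {: 'I_k * 'I_n}) B_extra xi_B.
have [B'r B'c B'0] := B'_extra; have [B'z B'1 B'M] := B'r.
(* Identities between elements of B' pass from T to [None]; the verifications below are of this
   kind. *)
have B'B f g : B' f -> B' g -> (forall t, f (Some t) = g (Some t)) -> f None = g None.
  move=> Bf Bg fg; apply/eqP; rewrite -subr_eq0; apply/eqP.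
  apply: (B'0 (f - g)); first by case: B'z => _; apply.
  by move=> t; rewrite addrfctE opprfctE fg subrr.
have B'gz e : B' (gz (enum_rank e)) by apply: BB'.
have gzE e t : gz (enum_rank e) (Some t) = gen e (mk_cycle t).
  by rewrite /= /genT enum_rankK.
(* The values al (i, j) satisfy the equations I, hence are the coordinates of a point of X. *)
have /choice[y yE] : forall i, exists yi, forall j, x j yi = al (i, j).
  move=> i; apply: (coord_onto hx) => p Ip.
  apply: (B'0 (fun o => p.@[fun j => oapp (xi i j) (al (i, j)) o])).
    apply: subalgebra_meval => // j; apply: (B'xi (i, j)); exact: mem_enum.
  by move=> t; apply: (coord_zero hx).
pose m i := z (enum_rank (inl (inl i) : gen_index)).
pose dl := z (enum_rank (inl (inr tt) : gen_index)).
pose mz i := gz (enum_rank (inl (inl i) : gen_index)).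
have m_disc : disc m * dl = 1.
  pose f := (\prod_(S : {set 'I_k} | S != finset.set0) \sum_(i in S) mz i) *
    gz (enum_rank (inl (inr tt) : gen_index)).
  have -> : disc m * dl = f None.
    rewrite /f mulrfctE fct_prodE; congr (_ * _).
    by apply: eq_bigr => S _; rewrite fct_sumE.
  apply: (B'B _ (fun=> 1)) => //.
    apply: B'M => //; apply: subring_prod => // S _; apply: zmod_set_sum => // i _.
    exact: B'gz.
  move=> t; rewrite /f mulrfctE gzE fct_prodE /=; set D := \prod_(S | _) _.
  have -> : D = disc (sval t.1); last by rewrite mulfV // disc_neq0.
  apply: eq_bigr => S _; rewrite fct_sumE; apply: eq_bigr => i _.
  exact: (gzE (inl (inl i))).
have m_punct (S : {set 'I_k}) : S != finset.set0 -> \sum_(i in S) m i != 0.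
  move=> S0; apply: contraNneq (oner_neq0 K) => mS0; rewrite -m_disc /disc.
  by rewrite (bigD1 S) //= mS0 !mul0r.
exists (mk_cycle (exist _ m m_punct, y)) => e.
rewrite -[in RHS](enum_valK e); case: (enum_val e) => [[i|[]]|a] //=.
  have d0 := disc_neq0 (exist _ m m_punct).
  by apply: (mulfI d0); rewrite divff //= m_disc.
pose f := \sum_i mz i * \prod_j (oapp (xi i j) (al (i, j)) ^+ a j).
have : f None = gz (enum_rank (inr a : gen_index)) None.
  apply: B'B => //.
    apply: zmod_set_sum => // i _; apply: B'M; first exact: B'gz.
    apply: subring_prod => // j _; apply: subringX => //.
    by apply: (B'xi (i, j)); apply: mem_enum.
  move=> t; rewrite gzE /f fct_sumE /=; apply: eq_bigr => i _.
  rewrite mulrfctE fct_prodE; congr (_ * _); first exact: (gzE (inl (inl i))).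
  by apply: eq_bigr => j _; rewrite exprfctE.
rewrite /= => <-; rewrite /f fct_sumE; apply: eq_bigr => i _ /=.
rewrite mulrfctE fct_prodE; congr (_ * _).
by apply: eq_bigr => j _; rewrite exprfctE /= yE.
Qed.

Lemma cycle_coordinates : @coordinates K (cycle_space X) #|gen_index|
  [set p | forall w, p.@[fun e => gen (enum_val e) w] = 0]%classic
  (fun e => gen (enum_val e)).
Proof.
split.
- move=> h; split=> [/AN_regular/generated_mpoly[p pE]|[p ->]].
    exists p; apply: funext => w; have [t ->] := mk_cycle_surj w.
    exact: (congr1 (fun f => f t) pE).
  apply: subalgebra_meval; first exact: generated_subalgebra.
  by move=> e; apply: regular_gen.
- move=> w w' ww'; apply: gen_inj => e; have := ww' (enum_rank e).
  by rewrite enum_rankK.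
- by move=> p w; apply.
- exact: gen_closed.
Qed.

End Box.

Lemma cycle_space_affine_coordinates : is_affine (cycle_space X).
Proof.
have red j : exists d : nat, exists c : 'I_d -> T -> K, (forall l, A0 (c l)) /\
    forall i t, xi i j t ^+ d = \sum_l c l t * xi i j t ^+ l.
  exact: (@power_sums_monic K T A0 k mu (xi^~ j) A0_subring A0_mu A0_unit (A0_psum j)).
have [d dP] := choice red.
(* One N must bound both k, for the power sums in [base_gens], and the degrees of all the monic
   equations. *)
apply: (coordinates_affine (@cycle_coordinates (k + \sum_j d j) _ _)).
  by rewrite ltnS leq_addr.
move=> j; have [c [Ac cE]] := dP j; exists (d j), c; split=> //.
by rewrite (bigD1 j) //=; lia.
Qed.

End Affine.

Lemma cycle_space_affine (X : affvar K) : is_affine (cycle_space X).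
Proof.
have [n [I [x hx]]] := affine_coordinates X.
exact: cycle_space_affine_coordinates hx.
Qed.

Definition cycle_var (X : affvar K) : affvar K := Affvar (cycle_space_affine X).

Lemma cycle_weights_regular (X : affvar K) a : regular (punctured K k) a ->
  regular (cycle_var X) (a \o (fun z : cycles X => (sval z).1)).
Proof. by move=> ra; apply: generated_incl; left; exists a. Qed.

Definition cycle_over (X : affvar K) : Defs.over K k :=
  @Over K k (cycle_var X) (Mor (@cycle_weights_regular X)).

Lemma cycle_map_subproof (X Y : Type) (f : X -> Y) (z : cycles X) :
  exists y, (sval z).2 \o (fun h => h \o f) = weighted (sval (sval z).1) y.
Proof. by have [x zE] := svalP z; exists (f \o x); rewrite zE. Qed.

(** Pushforward of cycles: on linear forms it is composition with the pullback of functions, so no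
    points have to be chosen. *)
Definition cycle_map (X Y : Type) (f : X -> Y) (z : cycles X) : cycles Y :=
  exist _ ((sval z).1, (sval z).2 \o (fun h => h \o f)) (cycle_map_subproof f z).

Lemma cycle_map_regular (X Y : affvar K) (f : mor X Y) g :
  regular (cycle_var Y) g -> regular (cycle_var X) (g \o cycle_map f).
Proof.
apply: generated_min; first exact: generated_subalgebra.
move=> _ [[a ra ->]|[h rh ->]]; apply: generated_incl; [left|right].
  by exists a.
by exists (h \o f) => //; apply: mor_regular.
Qed.

Definition cycle_over_mor (X Y : affvar K) (f : mor X Y) :
    over_mor (cycle_over X) (cycle_over Y) :=
  @OverMor K k (cycle_over X) (cycle_over Y)
    (@Mor K (cycle_var X) (cycle_var Y) _ (@cycle_map_regular X Y f)) (fun=> erefl).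

Lemma cycle_map_id (X : affvar K) (z : cycle_over X) :
  cycle_over_mor (idmor X) z = z.
Proof. by apply: sval_inj => /=; case: (sval z). Qed.

Lemma cycle_map_comp (X Y Z : affvar K) (g : mor Y Z) (f : mor X Y)
    (z : cycle_over X) :
  cycle_over_mor (compmor g f) z = cycle_over_mor g (cycle_over_mor f z).
Proof. exact: sval_inj. Qed.

Definition cycle_functor : functor K k :=
  @Functor K k cycle_over cycle_over_mor cycle_map_id cycle_map_comp.

End WeightedCycles.

(** * Symmetric functions and strata *)

Section Selections.
Variables (J : finType) (R : comPzRingType).

(* The sum of F over the lists of r distinct elements of J. *)
Fixpoint selections (r : nat) (F : seq J -> R) : R :=
  if r is r'.+1 then selections r' (fun u => \sum_(j | j \notin u) F (j :: u))
  else F [::].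

Lemma eq_selections r F G :
  (forall u, uniq u -> size u = r -> F u = G u) -> selections r F = selections r G.
Proof.
elim: r F G => [|r IH] F G FG /=; first exact: FG.
by apply: IH => u uu su; apply: eq_bigr => j ju; apply: FG; rewrite /= ?ju ?su.
Qed.

Lemma selections_sum (I : Type) (s : seq I) (F : I -> seq J -> R) r :
  selections r (fun u => \sum_(l <- s) F l u) = \sum_(l <- s) selections r (F l).
Proof.
elim: r F => [//|r IH] F /=; rewrite -IH; apply: eq_selections => u _ _.
exact: exchange_big.
Qed.

Lemma selectionsB (F G : seq J -> R) r :
  selections r (fun u => F u - G u) = selections r F - selections r G.
Proof.
elim: r F G => [//|r IH] F G /=; rewrite -IH; apply: eq_selections => u _ _.
exact: sumrB.
Qed.

Lemma selectionsMl c (F : seq J -> R) r :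
  selections r (fun u => c * F u) = c * selections r F.
Proof.
elim: r F => [//|r IH] F /=; rewrite -IH; apply: eq_selections => u _ _.
by rewrite mulr_sumr.
Qed.

Lemma selections_const r c : selections r (fun=> c) = c *+ (#|J| ^_ r).
Proof.
elim: r c => [|r IH] c /=; first by rewrite ffactn0.
rewrite (eq_selections (G := fun=> c *+ (#|J| - r))); last first.
  move=> u uu su; rewrite sumr_const; congr (_ *+ _).
  rewrite -(cardC (mem u)) (card_uniqP uu) su addKn.
  by apply: eq_card => j; rewrite !inE.
by rewrite IH -mulrnA ffactnSr mulnC.
Qed.

End Selections.

Section Symmetrization.
Variables (K : fieldType) (X T : Type) (J : finType) (x : T -> J -> X).

Fixpoint list_prod (g : nat -> X -> K) (y : J -> X) (u : seq J) : K :=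
  if u is j :: u' then g 0%N (y j) * list_prod (g \o succn) y u' else 1.

Lemma list_prodE g y j0 u :
  list_prod g y u = \prod_(i < size u) g i (y (nth j0 u i)).
Proof.
elim: u g => [|j u IH] g /=; first by rewrite big_ord0.
by rewrite big_ord_recl IH.
Qed.

(** Records that a further index with factor h coincides with the e-th selected one. *)
Let absorb (h : X -> K) (g : nat -> X -> K) (e i : nat) : X -> K :=
  if i == e then h * g i else g i.

Lemma list_prod_absorb h g y u :
  (\sum_(j <- u) h (y j)) * list_prod g y u =
  \sum_(e < size u) list_prod (absorb h g e) y u.
Proof.
elim: u g => [|j u IH] g /=; first by rewrite big_nil big_ord0 mul0r.
rewrite big_cons big_ord_recl mulrDl mulrA mulrCA IH mulr_sumr /=.
by congr (_ + _); rewrite mulrA.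
Qed.

(** The sum over j outside u is the sum over all j minus the sum over j in u. The former gives a
    power sum times a selection sum of length r; in the latter j repeats an entry of u, and [absorb]
    turns it into r selection sums of length r. *)
Lemma selections_mem (A : set (X -> K)) (B : set (T -> K)) :
    subring A -> subring B ->
    (forall h, A h -> B (fun t => \sum_j h (x t j))) ->
  forall r g, (forall i, A (g i)) ->
    B (fun t => selections r (list_prod g (x t))).
Proof.
move=> [_ _ AM] [Bz B1 BM] AB; elim=> [//|r IH] g Ag.
have -> : (fun t => selections r.+1 (list_prod g (x t))) =
    (fun t => \sum_j g 0%N (x t j)) *
      (fun t => selections r (list_prod (g \o succn) (x t))) -
    \sum_(e < r) (fun t =>
      selections r (list_prod (absorb (g 0%N) (g \o succn) e) (x t))).
  apply: funext => t; rewrite /= addrfctE opprfctE mulrfctE fct_sumE.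
  rewrite -selectionsMl -selections_sum -selectionsB.
  apply: eq_selections => u uu <-; rewrite -list_prod_absorb -mulrBl -mulr_suml.
  congr (_ * _); rewrite (big_uniq _ uu) /= [X in _ = X - _](bigID (mem u)) /=.
  by rewrite addrAC subrr add0r.
have [_ BB] := Bz; apply: BB.
  by apply: BM; [apply: AB|apply: IH => i] => /=.
apply: zmod_set_sum => // e _; apply: IH => i; rewrite /absorb.
by case: ifP => _ /=; [apply: AM|]; apply: Ag.
Qed.

End Symmetrization.

(** * Regular functions on powers and symmetric powers *)

Section PowerRing.
Variables (K : closedFieldType) (X : affvar K) (d : nat).

Lemma power_regular_sum (I : finType) (c : I -> K) (g : I -> 'I_d -> X -> K) :
  (forall l i, regular X (g l i)) ->
  regular (power X d) (fun x => \sum_l c l * \prod_i g l i (x i)).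
Proof.
move=> rg; exists #|I|, (c \o enum_val), (fun l => g (enum_val l)); split=> // x.
rewrite (reindex_onto enum_val enum_rank) /=; last by move=> l _; rewrite enum_rankK.
by apply: eq_bigl => l; rewrite enum_valK eqxx.
Qed.

Lemma power_regular_coord i h : regular X h -> regular (power X d) (fun x => h (x i)).
Proof.
move=> rh; have [[_ X1 _] _] := regular_subalgebra X.
have := @power_regular_sum 'I_1 (fun=> 1) (fun _ j => if j == i then h else 1).
rewrite (_ : (fun x : 'I_d -> X => \sum_l _) = fun x => h (x i)).
  by apply=> _ j; case: ifP.
apply: funext => x; rewrite big_ord1 mul1r (bigD1 i) //= eqxx big1 ?mulr1 //.
by move=> j /negPf ->.
Qed.

Lemma power_subalgebra : subalgebra (regular (power X d)).
Proof.
have [[Xz X1 XM] _] := regular_subalgebra X.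
have pconst c : regular (power X d) (fun=> c).
  have := @power_regular_sum 'I_1 (fun=> c) (fun _ _ => 1) (fun _ _ => X1).
  congr (regular _ _); apply: funext => x.
  by rewrite big_ord_recl big_ord0 big1 ?mulr1 ?addr0.
split=> //; split; first split; try exact: pconst.
- move=> f f' [N [c [g [rg fE]]]] [N' [c' [g' [rg' fE']]]].
  pose c2 (l : 'I_N + 'I_N') := match l with inl l => c l | inr l => - c' l end.
  pose g2 (l : 'I_N + 'I_N') := match l with inl l => g l | inr l => g' l end.
  have -> : f - f' = fun x => \sum_l c2 l * \prod_i g2 l i (x i).
    apply: funext => x; rewrite big_sumType /= addrfctE opprfctE fE fE' -sumrN.
    by congr (_ + _); apply: eq_bigr => l _; rewrite mulNr.
  by apply: power_regular_sum => -[].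
- move=> f f' [N [c [g [rg fE]]]] [N' [c' [g' [rg' fE']]]].
  pose c2 (l : 'I_N * 'I_N') := c l.1 * c' l.2.
  pose g2 (l : 'I_N * 'I_N') i := g l.1 i * g' l.2 i.
  have -> : f * f' = fun x => \sum_l c2 l * \prod_i g2 l i (x i).
    apply: funext => x; rewrite mulrfctE fE fE' mulr_suml.
    under eq_bigr do rewrite mulr_sumr.
    rewrite pair_big; apply: eq_bigr => l _ /=.
    by rewrite mulrACA -big_split.
  by apply: power_regular_sum => l i; apply: XM.
Qed.

Lemma sym_subalgebra : subalgebra (regular (sym X d)).
Proof.
have [[[p0 pB] p1 pM] pc] := power_subalgebra.
split=> [|c]; last exact: pc.
by split; [split; [exact: p0|move=> f g; exact: pB]|exact: p1|move=> f g; exact: pM].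
Qed.

End PowerRing.

Lemma subspace_subalgebra (K : closedFieldType) (Y : fspace K) (A : set Y) :
  subalgebra (regular Y) -> subalgebra (regular (subspace A)).
Proof.
move=> [[[Y0 YB] Y1 YM] Yc]; split=> [|c]; last by exists (fun=> c).
split; first split.
- by exists 0.
- move=> f g [f' rf fE] [g' rg gE]; exists (f' - g') => [|y]; first exact: YB.
  by rewrite !addrfctE !opprfctE fE gE.
- by exists 1.
- move=> f g [f' rf fE] [g' rg gE]; exists (f' * g') => [|y]; first exact: YM.
  by rewrite !mulrfctE fE gE.
Qed.

(** * Cycles with natural multiplicities and their linear forms *)

Section CycleOf.
Variables (K : fieldType) (T : Type).
Hypothesis K0 : [pchar K] =i pred0.

Lemma sum_cycle_of k (m : 'I_k -> nat) (x : 'I_k -> T) (h : T -> K)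
    (s : seq {classic T}) :
  uniq s -> (forall i, (x i : {classic T}) \in s) ->
  \sum_i (m i)%:R * h (x i) = \sum_(p <- s) (cycle_of m x p)%:R * h p.
Proof.
move=> us xs; under [RHS]eq_bigr do rewrite natr_sum mulr_suml.
rewrite exchange_big; apply: eq_bigr => i _ /=.
rewrite (bigD1_seq (x i : {classic T})) //= asboolT // muln1 big1 ?addr0 //.
move=> p px; rewrite asboolF ?muln0 ?mul0r // => xp.
by case/eqP: px.
Qed.

Lemma cycle_of_sum k k' (m : 'I_k -> nat) (m' : 'I_k' -> nat)
    (x : 'I_k -> T) (x' : 'I_k' -> T) (h : T -> K) :
  cycle_of m x = cycle_of m' x' ->
  \sum_i (m i)%:R * h (x i) = \sum_i (m' i)%:R * h (x' i).
Proof.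
move=> xx'; pose y : 'I_k -> {classic T} := x; pose y' : 'I_k' -> {classic T} := x'.
have us : uniq (undup (codom y ++ codom y')) by apply: undup_uniq.
rewrite (sum_cycle_of m h us) => [|i]; last first.
  by rewrite mem_undup mem_cat (codom_f y).
rewrite (sum_cycle_of m' h us) => [|i]; last first.
  by rewrite mem_undup mem_cat (codom_f y') orbT.
by rewrite xx'.
Qed.

Lemma natr_inj_pchar0 : injective (fun n => n%:R : K).
Proof.
have /pcharf0P nat0 := K0.
move=> a b; wlog ab : a b / (a <= b)%N.
  by case/orP: (leq_total a b) => ab H e; [|apply/esym]; apply: H.
move=> /= /eqP; rewrite eq_sym -subr_eq0 -natrB // nat0 subn_eq0 => ba.
by apply/eqP; rewrite eqn_leq ab.
Qed.

(** Indicator functions recover the multiplicities as elements of K, and characteristic 0 recovers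
    them as natural numbers. *)
Lemma cycle_of_inj k k' (m : 'I_k -> nat) (m' : 'I_k' -> nat)
    (x : 'I_k -> T) (x' : 'I_k' -> T) :
  (forall h : T -> K,
     \sum_i (m i)%:R * h (x i) = \sum_i (m' i)%:R * h (x' i)) ->
  cycle_of m x = cycle_of m' x'.
Proof.
move=> xx'; apply: funext => p; apply: natr_inj_pchar0.
rewrite /cycle_of !natr_sum; under eq_bigr do rewrite natrM.
by under [in RHS]eq_bigr do rewrite natrM; apply: xx' (fun y => `[< y = p >]%:R).
Qed.

End CycleOf.

(** [tagnat] cuts the ordinals into consecutive blocks of lengths P i, so [sig1] takes the value i
    exactly P i times. *)
Lemma sum_tagnat (V : nmodType) k (P : 'I_k -> nat) (g : 'I_k -> V) :
  \sum_(j < \sum_i P i) g (tagnat.sig1 j) = \sum_i g i *+ P i.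
Proof.
rewrite (reindex tagnat.rank) /=; last first.
  by exists tagnat.sig => j _; [exact: tagnat.rankK|exact: tagnat.sigK].
under [RHS]eq_bigr do rewrite -[P _]card_ord -sumr_const.
rewrite sig_big_dep /=.
by apply: eq_bigr => -[i j] _ /=; rewrite tagnat.rankE tagnat.Rank1K.
Qed.

Lemma cycle_of_tagnat (T : Type) k (P : 'I_k -> nat) (x : 'I_k -> T) :
  cycle_of (fun=> 1%N) (fun j : 'I_(\sum_i P i) => x (tagnat.sig1 j)) = cycle_of P x.
Proof.
apply: funext => p; rewrite /cycle_of.
pose g i : nat := `[< x i = p >].
transitivity (\sum_(j < \sum_i P i) g (tagnat.sig1 j))%N.
  by apply: eq_bigr => j _; rewrite mul1n.
rewrite (sum_tagnat P g); apply: eq_bigr => i _.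
by elim: (P i) => // n IH; rewrite mulrS IH mulSn.
Qed.

(** Such a u lists every index once. The default i of [nth] is never reached and avoids choosing an
    element of a possibly empty ordinal type. *)
Lemma sym_quot_uniq (T : Type) d (x : 'I_d -> T) (u : seq 'I_d) :
  uniq u -> size u = d -> sym_quot (fun i => x (nth i u i)) = sym_quot x.
Proof.
move=> uu su; apply: sval_inj; apply: funext => p; rewrite /= /cycle_of.
case: d x u uu su => [|d] x u uu su; first by rewrite !big_ord0.
have u_all : perm_eq (index_enum 'I_d.+1) u.
  rewrite uniq_perm ?index_enum_uniq // => j; rewrite mem_index_enum; apply/esym.
  have H : #|u| = #|'I_d.+1| by rewrite (card_uniqP uu) su card_ord.
  exact: (elimT (subset_cardP H) (subset_predT _) j).
rewrite [RHS](perm_big u) //=.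
rewrite [RHS](big_nth ord0) big_mkord.
rewrite -(big_mkord predT (fun i => 1 * `[< x (nth ord0 u i) = p >])%N) su big_mkord.
by apply: eq_bigr => i _; rewrite (set_nth_default ord0) // su.
Qed.

Lemma list_prod_ord (K : fieldType) (X : Type) d (g : nat -> X -> K) (y : 'I_d -> X)
    (u : seq 'I_d) :
  size u = d -> list_prod g y u = \prod_(i < d) g i (y (nth i u i)).
Proof.
case: d y u => [|d] y u su; first by rewrite big_ord0 (size0nil su).
rewrite (list_prodE _ _ ord0).
rewrite -(big_mkord predT (fun i => g i (y (nth ord0 u i)))) su big_mkord.
by apply: eq_bigr => i _; rewrite (set_nth_default ord0) // su.
Qed.

(** Averaging over the d! orderings leaves G unchanged and turns each product of functions into a
    selection sum, which is a polynomial in power sums; characteristic 0 permits division by d!. *)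
Lemma sym_regular_mem (K : closedFieldType) (X : affvar K) (d : nat) (T : Type)
    (x : T -> 'I_d -> X) (B : set (T -> K)) :
    [pchar K] =i pred0 -> subalgebra B ->
    (forall h, regular X h -> B (fun t => \sum_j h (x t j))) ->
  forall G, regular (sym X d) G -> B (fun t => G (sym_quot (x t))).
Proof.
move=> /pcharf0P K0 [Br Bc] BX G [N [c [g [rg GE]]]].
have [Xr _] := regular_subalgebra X; have [_ X1 _] := Xr.
have [Bz _ BM] := Br.
(* [list_prod] takes factors indexed by all of nat, so those beyond d are filled with 1. *)
pose g' (l : 'I_N) (i : nat) : X -> K :=
  if insub i is Some i' then g l i' else 1.
have rg' l i : regular X (g' l i) by rewrite /g'; case: insub.
have symE t : G (sym_quot (x t)) *+ d`! =
    \sum_l c l * selections d (list_prod (g' l) (x t)).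
  have -> : d`! = (#|'I_d| ^_ d)%N by rewrite card_ord ffactnn.
  rewrite -selections_const.
  under [RHS]eq_bigr do rewrite -selectionsMl; rewrite -selections_sum.
  apply: eq_selections => u uu su; rewrite -(sym_quot_uniq _ uu su) GE.
  apply: eq_bigr => l _; congr (_ * _).
  by rewrite list_prod_ord //; apply: eq_bigr => i _; rewrite /g' valK.
have -> : (fun t => G (sym_quot (x t))) = (fun=> (d`!%:R)^-1) *
    \sum_l (fun=> c l) * (fun t => selections d (list_prod (g' l) (x t))).
  apply: funext => t; rewrite mulrfctE fct_sumE.
  under [in RHS]eq_bigr do rewrite mulrfctE.
  rewrite -symE -[G _ *+ _]mulr_natl mulrA mulVf ?mul1r // K0.
  by rewrite -lt0n fact_gt0.
apply: (BM) => //; apply: zmod_set_sum => // l _; apply: (BM) => //.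
exact: selections_mem Xr Br BX _ _ (rg' l).
Qed.

(** * Identification of the fibers over natural weights with the strata *)

Section Fibers.
Variables (K : closedFieldType) (k : nat) (P : 'I_k -> nat).
Hypotheses (K0 : [pchar K] =i pred0) (P_gt0 : forall i, (0 < P i)%N).

Local Notation PK := (fun i : 'I_k => (P i)%:R : K).
Local Notation F := (cycle_functor K k).

Lemma natural_weights_punctured (S : {set 'I_k}) :
  S != finset.set0 -> \sum_(i in S) PK i != 0.
Proof.
have /pcharf0P nat0 := K0; move=> /set0Pn[i iS].
by rewrite -natr_sum nat0 (bigD1 i) //= -lt0n addn_gt0 P_gt0.
Qed.

Definition natural_weights : punctured K k := exist _ PK natural_weights_punctured.

Section OneVariety.
Variable X : affvar K.

Lemma stratum_cycle (x : 'I_k -> X) :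
  exists y : 'I_(\sum_i P i) -> X, cycle_of P x = cycle_of (fun=> 1%N) y.
Proof. by exists (fun j => x (tagnat.sig1 j)); rewrite cycle_of_tagnat. Qed.

Definition mk_stratum (x : 'I_k -> X) : stratum X P :=
  exist _ (exist _ (cycle_of P x) (stratum_cycle x)) (ex_intro _ x erefl).

Lemma mk_fiber_subproof (x : 'I_k -> X) i :
  sval (over_str (F X) (mk_cycle (natural_weights, x))) i = (P i)%:R.
Proof. by []. Qed.

Definition mk_fiber (x : 'I_k -> X) : fiber (F X) P :=
  exist _ (mk_cycle (natural_weights, x) : F X) (mk_fiber_subproof x).

Definition form (y : fiber (F X) P) : (X -> K) -> K := (sval (sval y : cycles K k X)).2.

Lemma fiber_weights (y : fiber (F X) P) :
  (sval (sval y : cycles K k X)).1 = natural_weights.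
Proof. by apply: sval_inj; apply: funext => i; apply: (svalP y i). Qed.

Lemma fiber_point (y : fiber (F X) P) : exists x, form y = weighted PK x.
Proof.
have [x yE] := svalP (sval y : cycles K k X).
by exists x; rewrite /form yE fiber_weights.
Qed.

Lemma form_inj : injective form.
Proof.
move=> y y' yy'; apply: sval_inj; apply: (@sval_inj _ _ (sval y : cycles K k X)).
rewrite [LHS]surjective_pairing [RHS]surjective_pairing !fiber_weights.
by congr (_, _).
Qed.

Definition rep (y : fiber (F X) P) : 'I_k -> X := sval (cid (fiber_point y)).

Lemma repE y : form y = weighted PK (rep y).
Proof. exact: svalP (cid (fiber_point y)). Qed.

(** The representative is chosen, but by [fiber_to_stratumE] the cycle depends only on the form. *)
Definition fiber_to_stratum (y : fiber (F X) P) : stratum X P := mk_stratum (rep y).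

Lemma fiber_to_stratumE y x :
  sval (sval (fiber_to_stratum y)) = cycle_of P x <-> form y = weighted PK x.
Proof.
rewrite repE; split=> [yx|/funeqP yx].
  by apply: funext => h; apply: cycle_of_sum yx.
by apply: (cycle_of_inj K0) => h; apply: yx.
Qed.

Let fiber_subalgebra : subalgebra (regular (fiber (F X) P)).
Proof. by apply: subspace_subalgebra; apply: generated_subalgebra. Qed.

(** On the tuple that repeats the i-th point P i times, a power sum of h is the value of the form at
    h, which is regular on the fiber. *)
Lemma fiber_to_stratum_regular g :
  regular (stratum X P) g -> regular (fiber (F X) P) (g \o fiber_to_stratum).
Proof.
move=> [G rG gE].
pose x y (j : 'I_(\sum_i P i)) := rep y (tagnat.sig1 j).
have -> : g \o fiber_to_stratum = fun y => G (sym_quot (x y)).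
  apply: funext => y /=; rewrite gE; congr G; apply: sval_inj => /=.
  by rewrite cycle_of_tagnat.
apply: (sym_regular_mem K0 fiber_subalgebra) => // h rh.
exists (fun z : cycles K k X => (sval z).2 h).
  by apply: generated_incl; right; exists h.
move=> y; rewrite (sum_tagnat P (fun i => h (rep y i))).
have -> : (sval (sval y : cycles K k X)).2 h = form y h by [].
by rewrite repE; apply: eq_bigr => i _; rewrite mulr_natl.
Qed.

Definition stratum_rep (Z : stratum X P) : 'I_k -> X := sval (cid (svalP Z)).

Lemma stratum_repE Z : sval (sval Z) = cycle_of P (stratum_rep Z).
Proof. exact: svalP (cid (svalP Z)). Qed.

Definition stratum_to_fiber (Z : stratum X P) : fiber (F X) P := mk_fiber (stratum_rep Z).

Lemma stratum_to_fiber_regular g :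
  regular (fiber (F X) P) g -> regular (stratum X P) (g \o stratum_to_fiber).
Proof.
move=> [G rG gE].
have -> : g \o stratum_to_fiber = G \o (fun Z => sval (stratum_to_fiber Z)).
  by apply: funext => Z; apply: gE.
apply: generated_min rG.
  by apply: subspace_subalgebra; apply: sym_subalgebra.
move=> _ [[a ra ->]|[h rh ->]].
  (* The weights are fixed along the fiber, so functions from the base become constants. *)
  exists (fun=> a natural_weights) => //.
  by have [_] := sym_subalgebra X (\sum_i P i); apply.
have weight1 d (f : 'I_d -> K) : \sum_j 1%:R * f j = \sum_j f j.
  by apply: eq_bigr => j _; rewrite mul1r.
(* The sum of h over a chosen tuple of points of W depends only on W, so it pulls back to \sum_j
   h(x_j) on X^d. *)
pose w (W : zcycle X (\sum_i P i)) := sval (cid (svalP W)).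
have wE W : sval W = cycle_of (fun=> 1%N) (w W) by apply: svalP (cid (svalP W)).
exists (fun W => \sum_j h (w W j)).
  have [[Xz _ _] _] := power_subalgebra X (\sum_i P i).
  change (regular (power X (\sum_i P i)%N) (fun x => \sum_j h (w (sym_quot x) j))).
  have -> : (fun x : 'I_(\sum_i P i) -> X => \sum_j h (w (sym_quot x) j)) =
      \sum_j (fun x => h (x j)).
    apply: funext => x; rewrite fct_sumE.
    have := @cycle_of_sum K X _ _ _ _ _ _ h (wE (sym_quot x)).
    by rewrite (weight1 _ (fun j => h (x j))) (weight1 _ (fun j => h (w _ j))).
  by apply: zmod_set_sum => // j _; apply: power_regular_coord.
move=> Z /=; have := wE (sval Z); rewrite stratum_repE.
move=> /(@cycle_of_sum K X _ _ _ _ _ _ h).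
by rewrite (weight1 _ (fun j => h (w _ j))).
Qed.

Definition fiber_mor : mor (fiber (F X) P) (stratum X P) := Mor fiber_to_stratum_regular.

Lemma fiber_mor_iso : is_iso fiber_mor.
Proof.
exists (Mor stratum_to_fiber_regular); split=> [y|Z] /=.
  apply: form_inj; apply/esym/fiber_to_stratumE; exact: stratum_repE.
apply: sval_inj; apply: sval_inj; rewrite [RHS]stratum_repE.
exact/fiber_to_stratumE.
Qed.

End OneVariety.

(** [fiber_to_stratumE] translates both cycles into linear forms, where [fmap F f] is composition
    with the pullback along f. *)
Lemma fiber_mor_natural : natural_on_fibers fiber_mor.
Proof.
move=> X Y f y z x zE /fiber_to_stratumE yx; apply/fiber_to_stratumE.
by rewrite /form zE /= -/(form y) yx.
Qed.

End Fibers.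

Theorem theorem1p3 (R : realType) (k : nat) (hk : (0 < k)%N) :
  exists F : functor R[i] k,
    forall P : 'I_k -> nat, (forall i, 0 < P i)%N ->
      exists phi : forall X : affvar R[i], mor (fiber (F X) P) (stratum X P),
        (forall X : affvar R[i], is_iso (phi X)) /\ natural_on_fibers phi.
Proof.
exists (cycle_functor _ k) => P P_gt0.
have K0 : [pchar R[i]] =i pred0 := Num.Theory.pchar_num _.
exists (fiber_mor K0 P_gt0).
by split=> [X|]; [exact: fiber_mor_iso|exact: fiber_mor_natural].
Qed.
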